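(* Let $m\ge 2$ and let $(a_n^{(1)})_{n\ge 0},\ldots,(a_n^{(m)})_{n\ge 0}$ be $m$ infinite sequences of admissible partial quotients for the Jacobi--Perron algorithm, so that the multidimensional continued fraction $[(a_n^{(1)})_{n\ge0},\ldots,(a_n^{(m)})_{n\ge0}]$ converges to an $m$-tuple of real numbers $(\alpha_0^{(1)},\ldots,\alpha_0^{(m)})$, and let $\delta>0$. If $$a_n^{(1)}>\max\{|\tilde A_n^{(1)}|\,C_{n-1}^{\delta},\ |\tilde A_n^{(2)}|\,C_{n-1}^{\delta},\ \ldots,\ |\tilde A_n^{(m)}|\,C_{n-1}^{\delta}\}\qquad\text{for all } n\in\mathbb{N},$$ then all the real numbers $\alpha_0^{(1)},\ldots,\alpha_0^{(m)}$ are transcendental.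
   Context: $\mathbb{N}=\{1,2,3,\ldots\}$. The Jacobi--Perron algorithm applied to $(\alpha_0^{(1)},\ldots,\alpha_0^{(m)})\in\mathbb{R}^m$ produces, for $n\ge 0$, $a_n^{(i)}=\lfloor\alpha_n^{(i)}\rfloor$ for $i=1,\ldots,m$, $\alpha_{n+1}^{(1)}=\frac{1}{\alpha_n^{(m)}-a_n^{(m)}}$ and $\alpha_{n+1}^{(i)}=\frac{\alpha_n^{(i-1)}-a_n^{(i-1)}}{\alpha_n^{(m)}-a_n^{(m)}}$ for $i=2,\ldots,m$. Integer sequences $(a_n^{(1)})_{n\ge 0},\ldots,(a_n^{(m)})_{n\ge 0}$ are admissible if for all $n\ge 1$ one has $a_n^{(j)}\ge 0$ for $1\le j\le m$ and, for $0\le i\le m-1$, $$(a_n^{(1)},a_{n+1}^{(2)},\ldots,a_{n+i}^{(i+1)})\succeq(a_n^{(m-i+1)},a_{n+1}^{(m-i+2)},\ldots,a_{n+i-1}^{(m)},1),$$ where $\succeq$ is the lexicographic order (for $i=0$ this reads $a_n^{(1)}\ge 1$). Define $A_{-n}^{(i)}=\delta_{in}$ (Kronecker delta) for $n=1,\ldots,m+1$ and $A_n^{(i)}=\sum_{j=1}^m a_n^{(j)}A_{n-j}^{(i)}+A_{n-m-1}^{(i)}$ for $n\ge 0$, $i=1,\ldots,m$; and $C_{-m-1}=1$, $C_{-n}=0$ for $n=1,\ldots,m$, $C_n=\sum_{j=1}^m a_n^{(j)}C_{n-j}+C_{n-m-1}$ for $n\ge0$. For admissible infinite sequences the limits $\alpha_0^{(i)}=\lim_{n}A_n^{(i)}/C_n$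 exist, and the MCF is said to converge to $(\alpha_0^{(1)},\ldots,\alpha_0^{(m)})$. Finally $\tilde A_n^{(i)}=A_n^{(i)}C_{n-1}-A_{n-1}^{(i)}C_n$. *)

(* Defs.v *)
From HB Require Import structures.
From mathcomp Require Import all_boot all_order all_algebra.
From mathcomp Require Import all_classical all_reals all_analysis.

Set Implicit Arguments.
Unset Strict Implicit.
Unset Printing Implicit Defensive.
Import Order.TTheory GRing.Theory Num.Theory.
Import numFieldNormedType.Exports.
Local Open Scope ring_scope.

(* Superscripts are shifted by one throughout: for j : 'I_m, the sequence a j
   is (a_n^(j+1))_n, and similarly for the numerators A and the limits. *)

(* (a_n^(1), a_{n+1}^(2), ..., a_{n+k}^(k+1)), for k < m. *)
Definition adm_left (m : nat) (a : 'I_m -> nat -> int) (n k : nat) : seq int :=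
  [seq a j (n + j)%N | j : 'I_m <- enum 'I_m & (j <= k)%N].

(* (a_n^(m-k+1), a_{n+1}^(m-k+2), ..., a_{n+k-1}^(m), 1), for k < m. *)
Definition adm_right (m : nat) (a : 'I_m -> nat -> int) (n k : nat) : seq int :=
  rcons [seq a j (n + (j - (m - k)))%N | j : 'I_m <- enum 'I_m & (m - k <= j)%N] 1.

(* For k < m both words have length k + 1, so the convention of [seqlexi] for
   words of different lengths plays no role. *)
Definition admissible (m : nat) (a : 'I_m -> nat -> int) : Prop :=
  forall n, (1 <= n)%N ->
    (forall j : 'I_m, 0 <= a j n) /\
    (forall k, (k < m)%N -> (adm_right a n k <= adm_left a n k :> seqlexi int)%O).

(* [mcf_window a init n] is the window [:: X_{n-1}; X_{n-2}; ...; X_{-m-1}],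
   latest term first, of the solution X of
     X_n = \sum_(1 <= j <= m) a_n^(j) X_{n-j} + X_{n-m-1}    (n >= 0)
   with initial values X_{-p} = init (p - 1) for 1 <= p <= m + 1. *)
Fixpoint mcf_window (m : nat) (a : 'I_m -> nat -> int) (init : nat -> int)
    (n : nat) : seq int :=
  if n is n'.+1 then
    let w := mcf_window a init n' in
    (\sum_(j < m) a j n' * w`_j + w`_m) :: w
  else mkseq init m.+1.

Definition mcf_rec (m : nat) (a : 'I_m -> nat -> int) (init : nat -> int)
    (n : nat) : int := (mcf_window a init n.+1)`_0.

(* A_{-p}^(i+1) = 1 if p = i + 1, and 0 otherwise. *)
Definition mcf_num (m : nat) (a : 'I_m -> nat -> int) (i : 'I_m) : nat -> int :=
  mcf_rec a (fun p => (p == i)%:R).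

(* C_{-p} = 1 if p = m + 1, and 0 otherwise. *)
Definition mcf_den (m : nat) (a : 'I_m -> nat -> int) : nat -> int :=
  mcf_rec a (fun p => (p == m)%:R).

(* \tilde A_n^(i+1); meaningful for n >= 1 only, because of n.-1. *)
Definition mcf_tnum (m : nat) (a : 'I_m -> nat -> int) (i : 'I_m) (n : nat) : int :=
  mcf_num a i n * mcf_den a n.-1 - mcf_num a i n.-1 * mcf_den a n.

Definition mcf_converges_to (R : realType) (m : nat) (a : 'I_m -> nat -> int)
    (alpha : 'I_m -> R) : Prop :=
  forall i : 'I_m,
    ((mcf_num a i n)%:~R / (mcf_den a n)%:~R @[n --> \oo] --> alpha i)%classic.

Definition transcendental (R : realType) (x : R) : Prop :=
  ~ algebraicOver (ratr : rat -> R) x.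

(* Main.v *)
Require Import Defs.
From HB Require Import structures.
From mathcomp Require Import all_boot all_order all_algebra.
From mathcomp Require Import all_classical all_reals all_analysis.
From mathcomp Require Import zify ring lra perm.

Set Implicit Arguments.
Unset Strict Implicit.
Unset Printing Implicit Defensive.
Import Order.TTheory GRing.Theory Num.Theory.
Import numFieldNormedType.Exports.
Local Open Scope ring_scope.

(** The growth condition gives |A_n/C_n - A_{n-1}/C_{n-1}| <= C_{n-1}^(-2-delta),
    and a nonzero step forces C_n >= 2 C_{n-1}; so the steps telescope, and
    |alpha - A_n/C_n| <= 2 C_n^(-2-delta).  If alpha were algebraic, Roth's
    theorem would bound the reduced denominators of the A_n/C_n, which would
    then be eventually constant.  But a relation Q A_n = P C_n that holds for
    all large n can be propagated backwards through the recurrence, down to the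
    initial values, where it fails.

    Roth's theorem is obtained by the classical method.  Siegel's lemma, with
    a variance estimate for the number of monomials of small weight, yields an
    integral polynomial in k variables vanishing to high weighted order at
    (alpha, ..., alpha).  By Taylor's formula it also vanishes to a positive
    weighted order at (p_1/q_1, ..., p_k/q_k) for k very good approximations.
    When the q_h increase fast enough this contradicts Roth's lemma, which is
    proved by induction on k: a generalized Wronskian splits as a product U V
    with V depending on the last variable and U on the other ones. *)

(** * Iterated polynomials *)

(* The outermost variable of [mpol R k.+1] is the variable number [k]; it comes
   first in the multi-indices, which are lists of length [k.+1]. *)

(** So the error is compared with differences of a decreasing function of C_n, and Roth's theorem is
    stated as a bound on reduced denominators, not as a finiteness statement about irrational
    numbers: rational limits and repeated convergents then need no separate treatment.

    In Roth's method the degrees r_h are chosen with r_h ln q_h almost constant, so that with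
    weights 1/r_h all variables count equally. Most monomials have weight near k/2, hence order
    slightly below k/2 at alpha can be imposed. At the rational point the derivatives of small
    weight are then of size about exp(-(2+delta) L k/2), while their common denominator is about
    exp(k L), where L is the common value of r_h ln q_h; since (2+delta) k/2 > k, they vanish. Each
    condition at alpha costs as many integral equations as the degree d of a polynomial having alpha
    as a root, so the proportion of small monomials must fall below 1/(2d). This forces k to grow
    with d and with 1/delta. *)

Fixpoint mpol (R : idomainType) (k : nat) : idomainType :=
  if k is k'.+1 then {poly mpol R k'} else R.

Fixpoint mpolC (R : idomainType) k : {rmorphism R -> mpol R k} :=
  match k return {rmorphism R -> mpol R k} with
  | 0 => idfun
  | k'.+1 => (polyC \o mpolC R k' : {rmorphism R -> {poly mpol R k'}})
  end.

(** Divided derivatives instead of iterated ones: they preserve integral coefficients, and binomial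
    coefficients are at most a power of 2, whereas factorials would ruin the norm estimates. *)
Fixpoint hasse (R : idomainType) k (I : seq nat) : {additive mpol R k -> mpol R k} :=
  match k return {additive mpol R k -> mpol R k} with
  | 0 => idfun
  | k'.+1 => (nderivn (head 0%N I) \o map_poly (hasse R k' (behead I))
       : {additive {poly mpol R k'} -> {poly mpol R k'}})
  end.

Fixpoint mdeg (R : idomainType) (r : nat -> nat) k : mpol R k -> Prop :=
  match k return mpol R k -> Prop with
  | 0 => fun _ => True
  | k'.+1 => fun P => (size (P : {poly mpol R k'}) <= (r k').+1)%N /\
                      forall i, mdeg r (P : {poly mpol R k'})`_i
  end.

Section Euler.
Variable R : idomainType.
Implicit Types (N : nat -> nat).

(* [\sum_h N h * X_h * d/dX_h]; it is diagonal on monomials. *)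
Fixpoint euler N k : mpol R k -> mpol R k :=
  match k return mpol R k -> mpol R k with
  | 0 => fun _ => 0
  | k'.+1 => fun P =>
     \poly_(i < size (P : {poly mpol R k'}))
       (euler N (P : {poly mpol R k'})`_i + (P : {poly mpol R k'})`_i *+ (N k' * i))
  end.

Lemma euler0 N k : euler N (0 : mpol R k) = 0.
Proof. by case: k => [|k] //=; apply/polyP=> i; rewrite coef_poly size_poly0 coef0. Qed.

Lemma coef_euler N k (P : mpol R k.+1) i :
  (euler N P : {poly _})`_i = euler N (P : {poly _})`_i + (P : {poly _})`_i *+ (N k * i).
Proof.
rewrite /= coef_poly; case: ltnP => // hi.
by rewrite nth_default // euler0 mul0rn addr0.
Qed.

Lemma eulerD N k : {morph euler N (k := k) : P Q / P + Q}.
Proof.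
elim: k => [|k IH] P Q; first by rewrite /= addr0.
by apply/polyP=> i; rewrite coefD !coef_euler coefD IH mulrnDl addrACA.
Qed.

HB.instance Definition _ N k :=
  GRing.isSemiAdditive.Build _ _ (@euler N k) (conj (euler0 N k) (@eulerD N k)).

Lemma eulerM N k (P Q : mpol R k) : euler N (P * Q) = euler N P * Q + P * euler N Q.
Proof.
elim: k P Q => [|k IH] P Q; first by rewrite /= mul0r mulr0 addr0.
apply/polyP=> i; rewrite coefD coef_euler !coefM raddf_sum -sumrMnl -!big_split /=.
apply: eq_bigr => j _; rewrite !coef_euler IH.
have -> : (N k * i = N k * j + N k * (i - j))%N by rewrite -mulnDr subnKC // -ltnS.
rewrite mulrnDr mulrDl mulrDr mulrnAl mulrnAr.
by rewrite -!addrA; congr (_ + _); rewrite addrCA.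
Qed.

Definition kron_comm N k (f : {rmorphism mpol R k -> {poly R}}) :
  commr_rmorph f ('X^(N k)) := fun x => mulrC _ _.

(* The Kronecker substitution [X_h := X^(N h)]. *)
Fixpoint kron N k : {rmorphism mpol R k -> {poly R}} :=
  match k return {rmorphism mpol R k -> {poly R}} with
  | 0 => polyC
  | k'.+1 => horner_morph (kron_comm N (kron N k'))
  end.

Lemma kronE N k (P : mpol R k.+1) n : (size (P : {poly mpol R k}) <= n)%N ->
  kron N k.+1 P = \sum_(i < n) kron N k (P : {poly _})`_i * 'X^(N k * i).
Proof.
move=> hn; rewrite /= /horner_morph (@horner_coef_wide _ n) ?(leq_trans (size_poly _ _)) //.
by apply: eq_bigr => i _; rewrite coef_map /= -exprM.
Qed.

(** The weights of [euler] are the exponents of the substitution, so both sides multiply the image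
    of a monomial by its exponent. *)
Lemma kron_euler N k (P : mpol R k) : kron N k (euler N P) = 'X * (kron N k P)^`().
Proof.
elim: k P => [|k IH] P; first by rewrite rmorph0 /= derivC mulr0.
rewrite !(kronE N (n := size (P : {poly mpol R k}))) ?size_poly //.
rewrite raddf_sum mulr_sumr; apply: eq_bigr => i _.
rewrite coef_euler rmorphD rmorphMn /= IH derivM derivXn mulrDr mulrDl.
rewrite mulrA; congr (_ + _).
case: (N k * i)%N => [|n]; first by rewrite !mulr0n mul0r !mulr0.
by rewrite mulrCA !mulrnAr -exprS mulrnAl.
Qed.

Lemma size_kron N (r : nat -> nat) k (P : mpol R k) :
  (forall h, h < k -> N h * (r h).+1 <= N h.+1)%N -> (0 < N 0)%N -> mdeg r P ->
  (size (kron N k P) <= N k)%N.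
Proof.
move=> hN N0; elim: k P hN => [|k IH] P hN /= hP.
  by rewrite (leq_trans (size_polyC_leq1 _)).
case: hP => hs hc; rewrite -/(kron N k.+1 P) (kronE N (leqnn _)).
apply: (leq_trans (size_sum _ _ _)); apply/bigmax_leqP => i _.
have hi := IH (P : {poly _})`_i (fun h hh => hN h (ltnW hh)) (hc i).
apply: leq_trans (hN k (leqnn _)).
have [->|nz] := eqVneq (kron N k (P : {poly _})`_i) 0; first by rewrite mul0r size_poly0.
rewrite size_mulXn // mulnS addnC leq_add // leq_mul2l orbC -ltnS.
by rewrite (leq_trans (ltn_ord i) hs).
Qed.

(** The exponents i_h <= r h are the digits of the sum of the [N h * i_h] in a mixed radix system,
    so distinct monomials have distinct images. *)
Lemma kron_inj N (r : nat -> nat) k (P : mpol R k) :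
  (forall h, h < k -> N h * (r h).+1 <= N h.+1)%N -> (0 < N 0)%N -> mdeg r P ->
  kron N k P = 0 -> P = 0.
Proof.
move=> hN N0; elim: k P hN => [|k IH] P hN /= hP.
  by move/eqP; rewrite polyC_eq0 => /eqP.
case: hP => hs hc; rewrite -/(kron N k.+1 P) (kronE N (leqnn _)) => h0.
have hN' h (hh : (h < k)%N) := hN h (ltnW hh).
have szc (i : nat) : (size (kron N k (P : {poly mpol R k})`_i)%R <= N k)%N.
  exact: size_kron hN' N0 (hc i).
apply/polyP => i; rewrite coef0; apply: IH => //.
have [hi|hi] := leqP (size (P : {poly mpol R k})) i; first by rewrite nth_default ?rmorph0.
apply/polyP => j; rewrite coef0.
have [hj|hj] := leqP (N k) j; first by rewrite nth_default ?(leq_trans (szc _)).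
(* With j < [N k], this coefficient comes from the block i only: blocks l > i start later, and
   blocks l < i have already ended by [szc]. *)
have := congr1 (fun p : {poly R} => p`_(N k * i + j)) h0.
rewrite coef0 coef_sum (bigD1 (Ordinal hi)) //= big1 ?addr0 => [|l].
  by rewrite coefMXn ltnNge leq_addr /= addKn.
rewrite -val_eqE /= coefMXn => nli; case: ltnP => // hl.
apply: nth_default; apply: leq_trans (szc l) _.
have Nk : (0 < N k)%N by apply: leq_ltn_trans hj.
have {}hl : (l <= i)%N.
  rewrite leqNgt; apply/negP => h; move: hl; rewrite leqNgt => /negP; apply.
  by rewrite (@leq_trans (N k * i.+1)%N) ?leq_mul2l ?h ?orbT // mulnS addnC ltn_add2r.
rewrite addnC -addnBA ?leq_mul2l ?hl ?orbT // -mulnBr.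
apply: leq_trans (leq_addl _ _); rewrite -{1}[N k]muln1 leq_mul2l subn_gt0.
by rewrite ltn_neqAle nli hl orbT.
Qed.

End Euler.

(** * Wronskians *)

Definition lin_indep (R : idomainType) (V : lmodType R) s (f : 'I_s -> V) :=
  forall c : 'I_s -> R, \sum_j c j *: f j = 0 -> forall j, c j = 0.

Lemma coefM_top (R : nzRingType) (p q : {poly R}) m n :
  (size p <= m.+1)%N -> (size q <= n.+1)%N -> (p * q)`_(m + n) = p`_m * q`_n.
Proof.
move=> hp hq; have hm : (m < (m + n).+1)%N by rewrite ltnS leq_addr.
rewrite coefM (bigD1 (Ordinal hm)) //= addKn big1 ?addr0 // => i.
rewrite -val_eqE /= => ni; have [hi|hi] := ltnP m i.
  by rewrite (nth_default _ (leq_trans hp hi)) mul0r.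
rewrite [X in _ * X]nth_default ?mulr0 //; apply: (leq_trans hq).
have lt_im : (i < m)%N by rewrite ltn_neqAle ni.
by lia.
Qed.

Lemma coef_prod_top (R : nzRingType) (I : Type) (l : seq I) (g : I -> {poly R}) (e : I -> nat) :
  (forall i, size (g i) <= (e i).+1)%N ->
  (size (\prod_(i <- l) g i)%R <= (\sum_(i <- l) e i).+1)%N /\
  (\prod_(i <- l) g i)`_(\sum_(i <- l) e i) = \prod_(i <- l) (g i)`_(e i).
Proof.
move=> hg; elim: l => [|x l [IHs IHc]].
  by rewrite !big_nil size_poly1 coef1.
rewrite !big_cons coefM_top // IHc; split=> //.
apply: (leq_trans (size_polyMleq _ _)).
apply: (@leq_trans ((e x).+1 + (\sum_(i <- l) e i).+1).-1).
  by rewrite -!subn1 leq_sub2r // leq_add.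
by rewrite addnS addSn.
Qed.

(** * Nonvanishing of the Wronskian in one variable *)

Section UnivariateWronskian.
Variable R : idomainType.
Hypothesis char0 : forall n : nat, n.+1%:R != 0 :> R.

(** X d/dX rather than d/dX: it multiplies X^n by n and does not lower degrees, so that top
    coefficients of determinants remain readable. *)
Definition theta (p : {poly R}) : {poly R} := 'X * p^`().

Lemma coef_theta_iter i p n : (iter i theta p)`_n = p`_n * n%:R ^+ i.
Proof.
elim: i => [|i IH]; first by rewrite expr0 mulr1.
rewrite /= coefXM; case: n IH => [|n] IH; first by rewrite exprS mul0r mulr0.
by rewrite /= coef_deriv IH -[LHS]mulr_natr exprSr mulrA.
Qed.

Lemma size_theta_iter i p : (size (iter i theta p) <= size p)%N.
Proof. by apply/leq_sizeP => j hj; rewrite coef_theta_iter nth_default ?mul0r. Qed.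

Lemma natr_inj0 (m n : nat) : m%:R = n%:R :> R -> m = n.
Proof.
wlog le_mn : m n / (m <= n)%N.
  by move=> H; case: (leqP m n) => [|/ltnW] h e; [|symmetry]; apply: H.
rewrite -(subnK le_mn) natrD => /eqP; rewrite -subr_eq0 opprD addrCA subrr addr0.
by case: (n - m)%N => // k; rewrite oppr_eq0 (negPf (char0 k)).
Qed.

Lemma coef_det_top s (M : 'M[{poly R}]_s) (e : 'I_s -> nat) :
  (forall i j, size (M i j) <= (e j).+1)%N ->
  (\det M)`_(\sum_j e j) = \det (\matrix_(i, j) (M i j)`_(e j)).
Proof.
move=> hM; rewrite /determinant coef_sum; apply: eq_bigr => t _.
have h i : (size (M i (t i)) <= (e (t i)).+1)%N by [].
have [_ E] := coef_prod_top (index_enum 'I_s) h.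
have -> : (\sum_j e j = \sum_i e (t i))%N by rewrite (reindex_inj (@perm_inj _ t)).
have -> : \prod_i (\matrix_(i, j) (M i j)`_(e j)) i (t i) = \prod_i (M i (t i))`_(e (t i)).
  by apply: eq_bigr => i _; rewrite mxE.
by rewrite -E !mulr_sign; case: (odd_perm t); rewrite ?coefN.
Qed.

Definition wron s (f : 'I_s -> {poly R}) := \det (\matrix_(i, j) iter i theta (f j)).

(** The coefficient of the Wronskian in degree the sum of the degrees is a Vandermonde determinant
    in those degrees, times the leading coefficients. Distinct degrees and characteristic 0 make it
    nonzero. *)
Lemma wron_inj s (f : 'I_s -> {poly R}) :
  (forall j, f j != 0) -> injective (fun j => size (f j)) -> wron f != 0.
Proof.
move=> nz inj; pose d j := (size (f j)).-1.
have sz j : (size (f j) <= (d j).+1)%N by rewrite /d; case: (size _).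
have dinj : injective d.
  by move=> i j /(congr1 S); rewrite /d -!polySpred // => /inj.
suff: (wron f)`_(\sum_j d j) != 0 by apply: contraNneq => ->; rewrite coef0.
rewrite coef_det_top; last first.
  by move=> i j; rewrite mxE (leq_trans (size_theta_iter _ _)).
have -> : (\matrix_(i, j) ((\matrix_(i, j) iter i theta (f j)) i j)`_(d j)) =
    Vandermonde s (\row_j (d j)%:R) *m diag_mx (\row_j (f j)`_(d j)).
  by apply/matrixP => i j; rewrite mul_mx_diag !mxE coef_theta_iter mulrC.
rewrite det_mulmx mulf_neq0 // ?det_diag.
  rewrite det_Vandermonde; apply/prodf_neq0 => i _; apply/prodf_neq0 => j lt_ij.
  rewrite !mxE subr_eq0; apply/eqP => /natr_inj0/dinj eij.
  by rewrite eij ltnn in lt_ij.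
by apply/prodf_neq0 => j _; rewrite mxE /d -lead_coefE lead_coef_eq0.
Qed.

Lemma theta_iterB a b i (p q : {poly R}) :
  iter i theta (a *: p - b *: q) = a *: iter i theta p - b *: iter i theta q.
Proof.
apply/polyP => n; rewrite coefB !coefZ !coef_theta_iter coefB !coefZ.
by rewrite mulrBl !mulrA.
Qed.

Lemma lin_indep_neq0 (V : lmodType R) s (f : 'I_s -> V) j : lin_indep f -> f j != 0.
Proof.
move=> li; apply/eqP => f0; suff /li/(_ j)/eqP : \sum_i (i == j)%:R *: f i = 0.
  by rewrite eqxx oner_eq0.
rewrite (bigD1 j) //= f0 scaler0 add0r big1 // => i /negPf ->.
by rewrite scale0r.
Qed.

Lemma size_cancel (p q : {poly R}) : p != 0 -> size p = size q ->
  (size (lead_coef q *: p - lead_coef p *: q)%R < size p)%N.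
Proof.
move=> nz e; rewrite (polySpred nz) ltnS; apply/leq_sizeP => n.
rewrite leq_eqVlt => /orP[/eqP <-|hn].
  by rewrite coefB !coefZ !lead_coefE -e mulrC subrr.
have hp : (size p <= n)%N by rewrite (polySpred nz).
by rewrite coefB !coefZ !nth_default ?mulr0 ?subr0 // -e.
Qed.

Lemma wron_elim s (f : 'I_s -> {poly R}) i j a b : i != j ->
  wron (fun l => if l == j then a *: f j - b *: f i else f l) = a%:P * wron f.
Proof.
move=> nij; pose g l := if l == j then f i else f l.
transitivity (a%:P * wron f + (- b%:P) * wron g); last first.
  suff -> : wron g = 0 by rewrite mulr0 addr0.
  rewrite /wron -det_tr; apply: (determinant_alternate nij) => l.
  by rewrite !mxE /g eqxx (negPf nij).
rewrite /wron -det_tr -[\det (\matrix_(_, _) iter _ _ (f _))]det_tr.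
rewrite -[\det (\matrix_(_, _) iter _ _ (g _))]det_tr.
apply: (determinant_multilinear (i0 := j)).
- apply/rowP => l; rewrite !mxE eqxx /g eqxx theta_iterB.
  by rewrite -!mul_polyC mulNr.
- by apply/matrixP => k l; rewrite !mxE eq_sym (negPf (neq_lift _ _)).
- by apply/matrixP => k l; rewrite !mxE /g eq_sym (negPf (neq_lift _ _)).
Qed.

Lemma lin_indep_elim (V : lmodType R) s (f : 'I_s -> V) i j a b : i != j -> a != 0 ->
  lin_indep f -> lin_indep (fun l => if l == j then a *: f j - b *: f i else f l).
Proof.
move=> nij a0 li c.
rewrite (bigD1 j) //= eqxx (eq_bigr (fun l => c l *: f l)) => [|l /negPf -> //].
move=> E.
pose c' l := if l == j then c j * a else if l == i then c i - c j * b else c l.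
have H : forall l, c' l = 0.
  apply: li; rewrite (bigD1 j) //= {1}/c' eqxx -{}[RHS]E scalerBr -!scalerA.
  rewrite -addrA; congr (_ + _).
  rewrite (bigD1 i) //= [in RHS](bigD1 i) //= addrA; congr (_ + _).
    by rewrite /c' (negPf nij) eqxx scalerBl addrC scalerA.
  by apply: eq_bigr => l /andP[/negPf h1 /negPf h2]; rewrite /c' h1 h2.
have cj : c j = 0.
  by have := H j; rewrite /c' eqxx => /eqP; rewrite mulf_eq0 (negPf a0) orbF => /eqP.
move=> l; have := H l; rewrite /c' cj; case: eqP => [-> //|_].
by case: eqP => [-> |//]; rewrite mul0r subr0.
Qed.

(** Induction on the total size: if two polynomials have equal size, their leading terms are
    cancelled. This multiplies the Wronskian by a nonzero constant and preserves independence; no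
    division occurs, as [R] is only a domain. *)
Lemma wron_neq0 s (f : 'I_s -> {poly R}) : lin_indep f -> wron f != 0.
Proof.
have [n] := ubnP (\sum_j size (f j)); elim: n => // n IH in f *.
rewrite ltnS => hn li.
have [inj|] := boolP (injectiveb (fun j => size (f j))).
  by apply: wron_inj => [j|]; [exact: lin_indep_neq0|exact/injectiveP].
case/injectivePn => i [j nij e].
have nzi : lead_coef (f i) != 0 by rewrite lead_coef_eq0 (lin_indep_neq0 i li).
have := IH _ _ (lin_indep_elim (b := lead_coef (f j)) nij nzi li).
rewrite wron_elim // mulf_eq0 negb_or => H.
suff /H/andP[] : (\sum_l size (if l == j then (lead_coef (f i) *: f j - lead_coef (f j) *: f i)%R
  else f l) < n)%N by [].
apply: leq_trans hn; rewrite (bigD1 j) //= [X in (_ <= X)%N](bigD1 j) //= eqxx.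
rewrite -addSn leq_add //.
  by apply: size_cancel; rewrite ?(lin_indep_neq0 j li).
by apply: leq_sum => l /negPf ->.
Qed.
End UnivariateWronskian.

(** Linear independence over the constants, written with products because [mpol R k] is given as a
    ring and not as an [R]-module. *)
Definition mindep (R : idomainType) k s (f : 'I_s -> mpol R k) :=
  forall c : 'I_s -> R, \sum_j mpolC R k (c j) * f j = 0 -> forall j, c j = 0.

Lemma coef_hasse (R : idomainType) k (I : seq nat) (P : mpol R k.+1) i :
  (hasse R k.+1 I P : {poly _})`_i =
  hasse R k (behead I) (P : {poly _})`_(head 0%N I + i) *+ 'C(head 0%N I + i, head 0%N I).
Proof. by rewrite /= coef_nderivn coef_map. Qed.

(* Linear combinations, with polynomial coefficients, of Hasse derivatives of
   order at most [n]. *)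
Inductive diffop (R : idomainType) k (n : nat) : (mpol R k -> mpol R k) -> Prop :=
| DiffopHasse I : size I = k -> (sumn I <= n)%N -> diffop n (hasse R k I)
| DiffopAdd op1 op2 : diffop n op1 -> diffop n op2 -> diffop n (fun P => op1 P + op2 P)
| DiffopMul c op : diffop n op -> diffop n (fun P => c * op P)
| DiffopExt op1 op2 : op1 =1 op2 -> diffop n op1 -> diffop n op2.

(** * Differential operators and Wronskians in several variables *)

Section GeneralizedWronskian.
Variable R : idomainType.

Lemma diffop_le k m n (op : mpol R k -> mpol R k) :
  (m <= n)%N -> diffop m op -> diffop n op.
Proof.
move=> le_mn; elim=> [I sI /leq_trans/(_ le_mn)|op1 op2 _ h1 _|c op' _|op1 op2 e _].
- exact: DiffopHasse.
- exact: DiffopAdd.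
- exact: DiffopMul.
- exact: DiffopExt.
Qed.

Lemma diffop_op0 k n (op : mpol R k -> mpol R k) : diffop n op -> op 0 = 0.
Proof.
elim=> [I _ _|op1 op2 _ -> _ ->|c op' _ ->|op1 op2 <- _ //]; first exact: raddf0.
  by rewrite addr0.
by rewrite mulr0.
Qed.

(** [op'] is the l-th Hasse derivative in the outer variable followed by [op] on each coefficient.
    It is specified by its coefficients only, so that the induction can lift the constituents of
    [op] separately. *)
Lemma diffop_lift k n l (op : mpol R k -> mpol R k) (op' : mpol R k.+1 -> mpol R k.+1) :
  diffop n op ->
  (forall P i, (op' P : {poly _})`_i = op (P : {poly _})`_(l + i) *+ 'C(l + i, l)) ->
  diffop (l + n) op'.
Proof.
move=> h; elim: h op' => [I sI hI|op1 op2 h1 IH1 h2 IH2|c op1 h1 IH1|op1 op2 e _ IH] op' E.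
- apply: (@DiffopExt _ _ _ (hasse R k.+1 (l :: I))) => [P|].
    by apply/polyP => i; rewrite coef_hasse E.
  by apply: DiffopHasse => /=; rewrite ?sI ?leq_add2l.
(* Truncating at the size of [P] loses nothing, since a [diffop] maps 0 to 0. *)
- pose o (op0 : mpol R k -> mpol R k) (P : mpol R k.+1) : mpol R k.+1 :=
    \poly_(i < size (P : {poly mpol R k})) (op0 (P : {poly _})`_(l + i) *+ 'C(l + i, l)).
  have oE op0 : diffop n op0 -> forall P i,
      (o op0 P : {poly _})`_i = op0 (P : {poly _})`_(l + i) *+ 'C(l + i, l).
    move=> h0 P i; rewrite /o coef_poly; case: ltnP => // hi.
    by rewrite nth_default ?(diffop_op0 h0) ?mul0rn // (leq_trans hi) ?leq_addl.
  apply: DiffopExt (DiffopAdd (IH1 _ (oE _ h1)) (IH2 _ (oE _ h2))) => P.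
  by apply/polyP => i; rewrite coefD !oE // E mulrnDl.
- pose o (P : mpol R k.+1) : mpol R k.+1 :=
    \poly_(i < size (P : {poly mpol R k})) (op1 (P : {poly _})`_(l + i) *+ 'C(l + i, l)).
  have oE P i : (o P : {poly _})`_i = op1 (P : {poly _})`_(l + i) *+ 'C(l + i, l).
    rewrite /o coef_poly; case: ltnP => // hi.
    by rewrite nth_default ?(diffop_op0 h1) ?mul0rn // (leq_trans hi) ?leq_addl.
  apply: DiffopExt (DiffopMul (c%:P : mpol R k.+1) (IH1 _ oE)) => P.
  by apply/polyP => i; rewrite coefCM oE E mulrnAr.
- by apply: IH => P i; rewrite E e.
Qed.

(** In the outer variable, X d/dX applied after the l-th Hasse derivative is (l+1) X times the
    (l+1)-st one. The Euler operator thus costs one order and a polynomial coefficient. *)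
Lemma diffop_euler_hasse N k I : size I = k ->
  diffop (sumn I).+1 (fun P : mpol R k => euler N (hasse R k I P)).
Proof.
elim: k I => [|k IH] I.
  case: I => // _.
  have h0 : diffop 1 (hasse R 0 [::]) by apply: DiffopHasse.
  by apply: DiffopExt (DiffopMul 0 h0) => P; rewrite mul0r.
case: I => // l I [sI].
pose o (P : mpol R k.+1) : mpol R k.+1 :=
  \poly_(i < size (P : {poly mpol R k}))
     (euler N (hasse R k I (P : {poly _})`_(l + i)) *+ 'C(l + i, l)).
have oE P i : (o P : {poly _})`_i =
    euler N (hasse R k I (P : {poly _})`_(l + i)) *+ 'C(l + i, l).
  rewrite /o coef_poly; case: ltnP => // hi.
  by rewrite nth_default ?raddf0 ?mul0rn // (leq_trans hi) ?leq_addl.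
have h1 : diffop (sumn (l :: I)).+1 o.
  by rewrite /= -addnS; exact: diffop_lift (IH _ sI) oE.
have h2 : diffop (sumn (l :: I)).+1 (hasse R k.+1 (l.+1 :: I)).
  by apply: DiffopHasse; rewrite /= ?sI.
pose c : mpol R k.+1 := ('X : {poly mpol R k}) *+ (N k * l.+1).
apply: DiffopExt (DiffopAdd h1 (DiffopMul c h2)) => P; rewrite {}/c.
apply/polyP => i; rewrite coefD oE coef_euler coef_hasse mulrnAl coefMn coefXM.
rewrite raddfMn; congr (_ + _).
case: i => [|i]; first by rewrite muln0 mulr0n mul0rn.
rewrite [i.+1.-1]/= [in LHS]coef_hasse [head _ _]/= [behead _]/= -!mulrnA addSnnS.
congr (_ *+ _) => /=.
by rewrite mulnCA [('C(_, l.+1) * _)%N]mulnC mul_bin_left addKn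
  [RHS]mulnCA [('C(_, l) * _)%N]mulnC.
Qed.

Lemma diffop_euler N k n (op : mpol R k -> mpol R k) : diffop n op ->
  diffop n.+1 (fun P => euler N (op P)).
Proof.
elim=> [I sI hI|op1 op2 _ h1 _ h2|c op' h h1|op1 op2 e _].
- exact: diffop_le (diffop_euler_hasse N sI).
- by apply: DiffopExt (DiffopAdd h1 h2) => P; rewrite raddfD.
- have h' := DiffopMul (euler N c) (diffop_le (leqnSn n) h).
  apply: DiffopExt (DiffopAdd h' (DiffopMul c h1)) => P.
  by rewrite eulerM.
- by apply: DiffopExt => P; rewrite e.
Qed.

Lemma hasse_nseq0 k (P : mpol R k) : hasse R k (nseq k 0%N) P = P.
Proof.
elim: k P => [//|k IH] P; apply/polyP => i.
by rewrite coef_hasse [behead _]/= IH [head _ _]/= add0n bin0 mulr1n.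
Qed.

Lemma diffop_euler_iter N k n : diffop n (fun P : mpol R k => iter n (@euler R N k) P).
Proof.
elim: n => [|n IH]; last exact: diffop_euler IH.
apply: DiffopExt (DiffopHasse R (size_nseq _ _) _) => [P|]; first exact: hasse_nseq0.
by rewrite sumn_nseq.
Qed.

Lemma diffop_choice k n (op : mpol R k -> mpol R k) s (f c : 'I_s -> mpol R k) :
  diffop n op -> \sum_j op (f j) * c j != 0 ->
  exists I, [/\ size I = k, (sumn I <= n)%N & \sum_j hasse R k I (f j) * c j != 0].
Proof.
elim=> [I sI hI nz|op1 op2 _ IH1 _ IH2|d op1 _ IH1|op1 op2 e _ IH].
- by exists I.
- rewrite (eq_bigr _ (fun j _ => mulrDl _ _ _)) big_split /= => nz.
  have [h|/IH1 //] := eqVneq (\sum_j op1 (f j) * c j) 0.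
  by apply: IH2; move: nz; rewrite h add0r.
- rewrite (eq_bigr _ (fun j _ => esym (mulrA _ _ _))) -mulr_sumr mulf_eq0 negb_or.
  by case/andP => _ /IH1.
- by rewrite (eq_bigr _ (fun j _ => congr1 ( *%R^~ (c j)) (esym (e (f j))))) => /IH.
Qed.

(** Rows are replaced one at a time. In the expansion along row n the cofactors do not involve that
    row, so some Hasse derivative occurring in [op n] keeps the sum nonzero. *)
Lemma diffop_det k s (f : 'I_s -> mpol R k) (op : 'I_s -> mpol R k -> mpol R k) :
  (forall i : 'I_s, diffop i (op i)) -> \det (\matrix_(i, j) op i (f j)) != 0 ->
  exists I : 'I_s -> seq nat, (forall i : 'I_s, size (I i) = k /\ (sumn (I i) <= i)%N) /\
    \det (\matrix_(i, j) hasse R k (I i) (f j)) != 0.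
Proof.
move=> hop nz.
pose M n (I : 'I_s -> seq nat) :=
  \matrix_(i, j) (if (i < n)%N then hasse R k (I i) (f j) else op i (f j)).
suff: forall n, (n <= s)%N -> exists I : 'I_s -> seq nat,
    (forall i : 'I_s, size (I i) = k /\ (sumn (I i) <= i)%N) /\ \det (M n I) != 0.
  case/(_ s (leqnn _)) => I [hI dI]; exists I; split=> //.
  by apply: contraNneq dI => <-; apply/eqP; congr (\det _);
    apply/matrixP => i j; rewrite !mxE ltn_ord.
elim=> [_|n IH lt_ns].
  exists (fun _ => nseq k 0%N); split=> [i|]; first by rewrite size_nseq sumn_nseq mul0n.
  by apply: contraNneq nz => <-; apply/eqP; congr (\det _);
    apply/matrixP => i j; rewrite !mxE ltn0.
have [I [hI dI]] := IH (ltnW lt_ns).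
pose i0 := Ordinal lt_ns; pose c j := cofactor (M n I) i0 j.
rewrite (expand_det_row _ i0) in dI.
have : \sum_j op i0 (f j) * c j != 0.
  apply: contraNneq dI => h0; rewrite -[X in _ == X]h0; apply/eqP.
  by apply: eq_bigr => j _; rewrite !mxE ltnn.
case/(diffop_choice (hop i0)) => J [sJ leJ dJ].
exists (fun i => if i == i0 then J else I i); split=> [i|]; first by case: eqP => [->|].
rewrite (expand_det_row _ i0); apply: contraNneq dJ => h0; rewrite -[X in _ == X]h0.
apply/eqP; apply: eq_bigr => j _.
rewrite !mxE ltnSn eqxx; congr (_ * _); rewrite /c /cofactor; congr (_ * \det _).
apply/matrixP => i j'; rewrite !mxE.
have /negPf ni : lift i0 i != i0 by rewrite eq_sym neq_lift.
rewrite ni; move: ni; rewrite -val_eqE /= ltnS => ni.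
by rewrite ltn_neqAle ni.
Qed.

Lemma mdeg_le (r r' : nat -> nat) k (P : mpol R k) :
  (forall h, h < k -> r h <= r' h)%N -> mdeg r P -> mdeg r' P.
Proof.
elim: k P => [//|k IH] P le_r [hs hc]; split=> [|i].
  by rewrite (leq_trans hs) // ltnS le_r.
by apply: IH (hc i) => h lt_hk; apply: le_r; apply: ltnW.
Qed.

Lemma mdeg0 r k : mdeg r (0 : mpol R k).
Proof. by elim: k => [//|k IH]; split=> [|i]; rewrite ?size_poly0 ?coef0. Qed.

Lemma mdegD r k (P Q : mpol R k) : mdeg r P -> mdeg r Q -> mdeg r (P + Q).
Proof.
elim: k P Q => [//|k IH] P Q [sP cP] [sQ cQ]; split=> [|i]; last first.
  by rewrite coefD; exact: IH (cP i) (cQ i).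
by rewrite (leq_trans (size_polyD _ _)) // geq_max sP.
Qed.

Lemma mdeg_sum r k (I : Type) (l : seq I) (A : pred I) (P : I -> mpol R k) :
  (forall i, A i -> mdeg r (P i)) -> mdeg r (\sum_(i <- l | A i) P i).
Proof.
by move=> h; apply: (big_ind (fun Q => mdeg r Q)) => //; [exact: mdeg0|exact: mdegD].
Qed.

Lemma mdegM r r' k (P Q : mpol R k) :
  mdeg r P -> mdeg r' Q -> mdeg (fun h => r h + r' h)%N (P * Q).
Proof.
elim: k P Q => [//|k IH] P Q [sP cP] [sQ cQ]; split=> [|i].
  apply: leq_trans (size_polyMleq _ _) _.
  move: sP sQ; set a := size P; set b := size Q; rewrite -/a -/b; lia.
by rewrite coefM; apply: mdeg_sum => j _; exact: IH (cP _) (cQ _).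
Qed.

Lemma mdegC k (c : R) : mdeg (fun _ => 0%N) (mpolC R k c).
Proof.
elim: k => [//|k IH]; split=> [|i]; first by rewrite size_polyC_leq1.
by rewrite coefC; case: ifP => _; [exact: IH|exact: mdeg0].
Qed.

Lemma mdegCM r k (c : R) (P : mpol R k) : mdeg r P -> mdeg r (mpolC R k c * P).
Proof. by move=> h; apply: mdeg_le (mdegM (mdegC k c) h) => i _; rewrite add0n. Qed.

Lemma mdeg_prod r k (I : Type) (l : seq I) (P : I -> mpol R k) :
  (forall i, mdeg r (P i)) -> mdeg (fun h => size l * r h)%N (\prod_(i <- l) P i).
Proof.
move=> hP; elim: l => [|x l IH]; first by rewrite big_nil -(rmorph1 (mpolC R k)); apply: mdegC.
by rewrite big_cons; apply: mdeg_le (mdegM (hP x) IH) => h _; rewrite mulSn.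
Qed.

Lemma mdeg_det r k s (M : 'M[mpol R k]_s) :
  (forall i j, mdeg r (M i j)) -> mdeg (fun h => s * r h)%N (\det M).
Proof.
move=> hM; apply: mdeg_sum => t _.
have -> : (-1) ^+ t = mpolC R k ((-1) ^+ t) by rewrite rmorphXn /= rmorphN1.
apply: mdegCM.
apply: mdeg_le (mdeg_prod (index_enum 'I_s) (fun i => hM i (t i))) => h _.
by rewrite [index_enum _]unlock -enumT size_enum_ord.
Qed.

Lemma mdeg_hasse r k I (P : mpol R k) : mdeg r P -> mdeg r (hasse R k I P).
Proof.
elim: k I P => [//|k IH] I P [sP cP]; split=> [|i].
  apply/leq_sizeP => j hj; rewrite coef_hasse nth_default ?raddf0 ?mul0rn //.
  by rewrite (leq_trans sP) // (leq_trans hj) // leq_addl.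
rewrite coef_hasse -mulr_natr; set n := 'C(_, _).
have -> : n%:R = mpolC R k n%:R by rewrite rmorph_nat.
by rewrite mulrC; apply: mdegCM; exact: IH (cP _).
Qed.

Lemma mdeg_bound (n : nat) k (c : nat -> mpol R k) :
  exists d, forall i, (i < n)%N -> mdeg (fun _ => d) (c i).
Proof.
elim: k n c => [|k IHk] n c; first by exists 0%N.
elim: n => [|n [d hd]]; first by exists 0%N.
have [e he] := IHk (size (c n : {poly mpol R k})) (nth 0 (c n : {poly mpol R k})).
exists (maxn (maxn d e) (size (c n : {poly mpol R k}))) => i.
rewrite ltnS leq_eqVlt => /orP[/eqP ->|/hd]; last first.
  by apply: mdeg_le => h _; rewrite -maxnA leq_maxl.
split=> [|j]; first exact: leq_trans (leq_maxr _ _) (leqnSn _).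
have [hj|hj] := ltnP j (size (c n : {poly mpol R k})).
  by apply: mdeg_le (he j hj) => h _; rewrite maxnAC leq_maxr.
rewrite nth_default //; exact: mdeg0.
Qed.

Lemma kronC N k (c : R) : kron R N k (mpolC R k c) = c%:P.
Proof.
elim: k => [//|k IH]; rewrite (kronE N (n := 1)) ?size_polyC_leq1 //.
by rewrite big_ord1 coefC /= IH muln0 expr0 mulr1.
Qed.

Hypothesis char0 : forall n : nat, n.+1%:R != 0 :> R.

(* The Kronecker substitution turns the Euler operator [euler N] into [X d/dX],
   hence reduces the claim to the univariate case. *)
Theorem generalized_wronskian k s (f : 'I_s -> mpol R k) : mindep f ->
  exists I : 'I_s -> seq nat, (forall i : 'I_s, size (I i) = k /\ (sumn (I i) <= i)%N) /\
    \det (\matrix_(i, j) hasse R k (I i) (f j)) != 0.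
Proof.
move=> li.
have [d hd] : exists d, forall j, mdeg (fun _ => d) (f j).
  have [d hd] := mdeg_bound s (fun i => if insub i is Some j then f j else 0).
  by exists d => j; have := hd j (ltn_ord j); rewrite valK.
(* Base d + 1 exceeds every partial degree of the [f j], and constant combinations stay within these
   degrees: the substitution is injective on their span. *)
pose N h := (d.+1 ^ h)%N.
have hN h : (h < k)%N -> (N h * d.+1 <= N h.+1)%N by rewrite /N expnSr.
have inj P : mdeg (fun _ => d) P -> kron R N k P = 0 -> P = 0.
  by apply: kron_inj.
apply: (diffop_det (op := fun i P => iter i (@euler R N k) P)).
  by move=> i; apply: diffop_euler_iter.
suff: kron R N k (\det (\matrix_(i < s, j < s) iter i (@euler R N k) (f j))) != 0.
  by apply: contraNneq => ->; rewrite rmorph0.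
rewrite -det_map_mx.
have -> : map_mx (kron R N k) (\matrix_(i < s, j < s) iter i (@euler R N k) (f j)) =
    \matrix_(i, j) iter i (@theta R) (kron R N k (f j)).
  apply/matrixP => i j; rewrite !mxE; elim: (nat_of_ord i) => //= n IH.
  by rewrite kron_euler IH.
apply: (wron_neq0 char0) => c E; apply: li; apply: inj.
  by apply: mdeg_sum => j _; apply: mdegCM.
rewrite rmorph_sum -[RHS]E; apply: eq_bigr => j _.
by rewrite rmorphM /= kronC mul_polyC.
Qed.
End GeneralizedWronskian.

(** * Norm, integrality, index *)

(** The sum of the absolute values of the coefficients, not their maximum: it is submultiplicative,
    so products cost no factor depending on the number of monomials. *)
Fixpoint mnorm (R : realFieldType) k : mpol R k -> R :=
  match k return mpol R k -> R with
  | 0 => fun x => `|x|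
  | k'.+1 => fun P => \sum_(i < size (P : {poly mpol R k'})) mnorm (P : {poly mpol R k'})`_i
  end.

Section Norm.
Variable R : realFieldType.

Lemma mnorm_ge0 k (P : mpol R k) : 0 <= mnorm P.
Proof. by elim: k P => [P|k IH P] /=; [exact: normr_ge0|apply: sumr_ge0]. Qed.

Lemma mnorm0 k : mnorm (0 : mpol R k) = 0.
Proof. by case: k => [|k] /=; rewrite ?normr0 // size_poly0 big_ord0. Qed.

Lemma mnormE k (P : mpol R k.+1) n : (size (P : {poly mpol R k}) <= n)%N ->
  mnorm P = \sum_(i < n) mnorm (P : {poly mpol R k})`_i.
Proof.
move=> hn; rewrite /= (big_ord_widen _ (fun i => mnorm (P : {poly mpol R k})`_i) hn).
rewrite big_mkcond; apply: eq_bigr => i _; case: ltnP => // hi.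
by rewrite nth_default // mnorm0.
Qed.

Lemma mnorm_coef k (P : mpol R k.+1) i : mnorm (P : {poly mpol R k})`_i <= mnorm P.
Proof.
have [hi|hi] := ltnP i (size (P : {poly mpol R k})); last first.
  by rewrite nth_default // mnorm0 mnorm_ge0.
rewrite /= (bigD1 (Ordinal hi)) //= lerDl; apply: sumr_ge0 => j _; exact: mnorm_ge0.
Qed.

Lemma mnormD k (P Q : mpol R k) : mnorm (P + Q) <= mnorm P + mnorm Q.
Proof.
elim: k P Q => [|k IH] P Q; first exact: ler_normD.
set n := maxn (size (P : {poly mpol R k})) (size (Q : {poly mpol R k})).
rewrite !(@mnormE _ _ n) ?leq_maxl ?leq_maxr ?size_polyD // -big_split /=.
by apply: ler_sum => i _; rewrite coefD.
Qed.

Lemma mnorm_sum k (I : Type) (l : seq I) (A : pred I) (F : I -> mpol R k) :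
  mnorm (\sum_(i <- l | A i) F i) <= \sum_(i <- l | A i) mnorm (F i).
Proof.
apply: (big_ind2 (fun P x => mnorm P <= x)) => // [|P x Q y hP hQ]; first by rewrite mnorm0.
by rewrite (le_trans (mnormD _ _)) // lerD.
Qed.

Lemma mnormC k c : mnorm (mpolC R k c) = `|c|.
Proof.
elim: k => [//|k IH]; rewrite (mnormE (n := 1)) ?size_polyC_leq1 //.
by rewrite big_ord1 coefC.
Qed.

Lemma mnormM k (P Q : mpol R k) : mnorm (P * Q) <= mnorm P * mnorm Q.
Proof.
elim: k P Q => [|k IH] P Q; first by rewrite /= normrM.
(* Replacing coefficients by their norms turns the norm into the value at 1 of a real polynomial,
   and evaluation is multiplicative. *)
pose h (P : {poly mpol R k}) : {poly R} := \poly_(i < size P) mnorm P`_i.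
have hE (S : {poly mpol R k}) i : (h S)`_i = mnorm S`_i.
  by rewrite coef_poly; case: ltnP => // hi; rewrite nth_default // mnorm0.
have h1 (S : {poly mpol R k}) : mnorm (S : mpol R k.+1) = (h S).[1].
  rewrite (horner_coef_wide _ (size_poly _ _)).
  by apply: eq_bigr => i _; rewrite hE expr1n mulr1.
rewrite (h1 P) (h1 Q) -hornerM.
set n := maxn (size (P * Q : {poly mpol R k})) (size (h P * h Q)).
rewrite (@mnormE _ _ n) ?leq_maxl // (@horner_coef_wide _ n) ?leq_maxr //.
apply: ler_sum => i _; rewrite expr1n mulr1 !coefM.
apply: le_trans (mnorm_sum _ _ _) _; apply: ler_sum => j _.
by rewrite !hE.
Qed.

Lemma mnormCM k c (P : mpol R k) : mnorm (mpolC R k c * P) <= `|c| * mnorm P.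
Proof. by rewrite -(mnormC k) mnormM. Qed.

Lemma mnorm_prod k (I : Type) (l : seq I) (F : I -> mpol R k) b :
  (forall i, mnorm (F i) <= b) -> mnorm (\prod_(i <- l) F i) <= b ^+ size l.
Proof.
move=> hb; elim: l => [|x l IH].
  by rewrite big_nil -(rmorph1 (mpolC R k)) mnormC normr1.
rewrite big_cons exprS (le_trans (mnormM _ _)) // ler_pM ?mnorm_ge0 //.
Qed.

Lemma mnorm_det k s (M : 'M[mpol R k]_s) b :
  (forall i j, mnorm (M i j) <= b) -> mnorm (\det M) <= s`!%:R * b ^+ s.
Proof.
move=> hM; apply: le_trans (mnorm_sum _ _ _) _.
have -> : s`!%:R * b ^+ s = \sum_(t : 'S_s) b ^+ s.
  by rewrite sumr_const card_Sn mulr_natl.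
apply: ler_sum => t _.
have -> : (-1) ^+ t = mpolC R k ((-1) ^+ t) by rewrite rmorphXn /= rmorphN1.
rewrite (le_trans (mnormCM _ _)) // normrX normrN1 expr1n mul1r.
have := mnorm_prod (index_enum 'I_s) (fun i => hM i (t i)).
by rewrite [index_enum _]unlock -enumT size_enum_ord.
Qed.

Lemma mnorm_hasse r k I (P : mpol R k) : mdeg r P ->
  mnorm (hasse R k I P) <= 2%:R ^+ (\sum_(h < k) r h) * mnorm P.
Proof.
elim: k I P => [|k IH] I P; first by rewrite big_ord0 mul1r.
move=> [sP cP]; set l := head 0%N I; set J := behead I.
have h n : mnorm (hasse R k J (P : {poly _})`_n *+ 'C(n, l))
     <= 2%:R ^+ (\sum_(h < k.+1) r h) * mnorm (P : {poly mpol R k})`_n.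
  have [hn|hn] := leqP (r k).+1 n.
    by rewrite nth_default ?raddf0 ?mul0rn ?mnorm0 ?mulr0 // (leq_trans sP).
  rewrite -[X in mnorm X]mulr_natr -(rmorph_nat (mpolC R k)) mulrC (le_trans (mnormCM _ _)) //.
  rewrite big_ord_recr /= addnC exprD -mulrA normr_nat ler_pM ?ler0n ?mnorm_ge0 ?IH //.
  rewrite -natrX ler_nat (leq_trans _ (leq_pexp2l _ (_ : n <= r k)%N)) //.
  have [hl|hl] := leqP l n; last by rewrite bin_small.
  rewrite -[in X in (_ <= X)%N](prednK (isT : 0 < 2)%N) -[X in (X ^ _)%N]addn1 expnDn.
  rewrite (bigD1 (inord l)) //= inordK ?ltnS // !exp1n !muln1.
    exact: leq_addr.
  exact: cP.
rewrite (@mnormE _ (hasse R k.+1 I P) (size (P : {poly mpol R k}))); last first.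
  apply/leq_sizeP => j hj; rewrite coef_hasse nth_default ?raddf0 ?mul0rn //.
  by rewrite (leq_trans hj) ?leq_addl.
rewrite (@mnormE _ P (l + size (P : {poly mpol R k}))) ?leq_addl // big_split_ord /= mulrDr.
apply: ler_wpDl.
  by apply: mulr_ge0; [rewrite exprn_ge0|apply: sumr_ge0 => i _; apply: mnorm_ge0].
rewrite mulr_sumr; apply: ler_sum => i _; rewrite coef_hasse; exact: h.
Qed.
End Norm.

Fixpoint mint (R : archiRealFieldType) k : mpol R k -> Prop :=
  match k return mpol R k -> Prop with
  | 0 => fun x => x \is a Num.int
  | k'.+1 => fun P => forall i, mint (P : {poly mpol R k'})`_i
  end.

Section Integral.
Variable R : archiRealFieldType.

Lemma mint0 k : mint (0 : mpol R k).
Proof. by elim: k => [|k IH] /=; [exact: rpred0|move=> i; rewrite coef0]. Qed.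

Lemma mintD k (P Q : mpol R k) : mint P -> mint Q -> mint (P + Q).
Proof.
elim: k P Q => [|k IH] P Q /= hP hQ; first exact: rpredD.
by move=> i; rewrite coefD; apply: IH.
Qed.

Lemma mint_sum k (I : Type) (l : seq I) (A : pred I) (F : I -> mpol R k) :
  (forall i, A i -> mint (F i)) -> mint (\sum_(i <- l | A i) F i).
Proof. by move=> h; apply: (big_ind (@mint R k)) => //; [exact: mint0|exact: mintD]. Qed.

Lemma mintM k (P Q : mpol R k) : mint P -> mint Q -> mint (P * Q).
Proof.
elim: k P Q => [|k IH] P Q hP hQ; first exact: rpredM.
by move=> i; rewrite coefM; apply: mint_sum => j _; apply: IH; [exact: hP|exact: hQ].
Qed.

Lemma mintC k c : c \is a Num.int -> mint (mpolC R k c).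
Proof.
move=> hc; elim: k => [//|k IH] i; rewrite coefC; case: ifP => _ //; exact: mint0.
Qed.

Lemma mint_prod k (I : Type) (l : seq I) (F : I -> mpol R k) :
  (forall i, mint (F i)) -> mint (\prod_(i <- l) F i).
Proof.
move=> h; apply: (big_ind (@mint R k)) => //; last exact: mintM.
by rewrite -(rmorph1 (mpolC R k)); apply: mintC; apply: rpred1.
Qed.

Lemma mintMn k (P : mpol R k) n : mint P -> mint (P *+ n).
Proof.
by move=> hP; elim: n => [|n IH]; rewrite ?mulrS; [exact: mint0|exact: mintD].
Qed.

Lemma mint_det k s (M : 'M[mpol R k]_s) : (forall i j, mint (M i j)) -> mint (\det M).
Proof.
move=> hM; apply: mint_sum => t _.
have -> : (-1) ^+ t = mpolC R k ((-1) ^+ t) by rewrite rmorphXn /= rmorphN1.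
apply: mintM; last exact: mint_prod.
by apply: mintC; rewrite rpredX // rpredN rpred1.
Qed.

Lemma mint_hasse k I (P : mpol R k) : mint P -> mint (hasse R k I P).
Proof.
elim: k I P => [//|k IH] I P hP i; rewrite coef_hasse; apply: mintMn; apply: IH.
exact: hP.
Qed.
End Integral.

Fixpoint mcoef (R : idomainType) k (I : seq nat) : mpol R k -> R :=
  match k return mpol R k -> R with
  | 0 => id
  | k'.+1 => fun P => mcoef (behead I) (P : {poly mpol R k'})`_(head 0%N I)
  end.

Section Coef.
Variable R : archiRealFieldType.

Lemma mcoef_neq0 k (P : mpol R k) : P != 0 -> exists I, mcoef I P != 0.
Proof.
elim: k P => [|k IH] P nz; first by exists [::].
have /IH [I hI] : lead_coef (P : {poly mpol R k}) != 0 by rewrite lead_coef_eq0.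
by exists ((size (P : {poly mpol R k})).-1 :: I).
Qed.

Lemma mcoefMC k I c (P : mpol R k) : mcoef I (P * mpolC R k c) = mcoef I P * c.
Proof. by elim: k I P => [//|k IH] I P /=; rewrite coefMC IH. Qed.

Lemma mcoef_int k I (P : mpol R k) : mint P -> mcoef I P \is a Num.int.
Proof. by elim: k I P => [//|k IH] I P hP; apply: IH; apply: hP. Qed.

Lemma mcoef_norm k I (P : mpol R k) : `|mcoef I P| <= mnorm P.
Proof. by elim: k I P => [//|k IH] I P; rewrite (le_trans (IH _ _)) ?mnorm_coef. Qed.

Lemma mcoef0 k I : mcoef I (0 : mpol R k) = 0.
Proof. by elim: k I => [//|k IH] I /=; rewrite coef0. Qed.

End Coef.

(* [vanishes r b th P]: the index of [P] at the point [b], with respect to the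
   weights [1 / r h], is at least [th]. *)
Fixpoint vanishes (R : realFieldType) (r : nat -> nat) (b : nat -> R) k (th : R) :
    mpol R k -> Prop :=
  match k return mpol R k -> Prop with
  | 0 => fun x => 0 < th -> x = 0
  | k'.+1 => fun P => forall l,
      vanishes r b (th - l%:R / (r k')%:R)
        ((P : {poly mpol R k'})^`N(l)).[mpolC R k' (b k')]
  end.

Fixpoint mweight (R : realFieldType) (r : nat -> nat) k (I : seq nat) : R :=
  if k is k'.+1 then (head 0%N I)%:R / (r k')%:R + mweight R r k' (behead I) else 0.

Lemma coef_comp_XaddC (A : comNzRingType) (p : {poly A}) c l :
  (p \Po ('X + c%:P))`_l = p^`N(l).[c].
Proof.
elim/poly_ind: p l => [|p d IH] l; first by rewrite comp_poly0 coef0 raddf0 horner0.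
rewrite comp_poly_MXaddC mulrDr coefD coefD coefMX coefMC coefC.
case: l => [|l] /=; first by rewrite IH !nderivn0 hornerMXaddC add0r.
by rewrite !IH addr0 nderivnMXaddC hornerD hornerMX.
Qed.

Lemma horner_nderivnM (A : comNzRingType) (p q : {poly A}) c l :
  (p * q)^`N(l).[c] = \sum_(i < l.+1) p^`N(i).[c] * q^`N(l - i).[c].
Proof.
rewrite -coef_comp_XaddC comp_polyM coefM.
by apply: eq_bigr => i _; rewrite !coef_comp_XaddC.
Qed.

Lemma hasseCM (R : idomainType) k I c (P : mpol R k) :
  hasse R k I (mpolC R k c * P) = mpolC R k c * hasse R k I P.
Proof.
elim: k I P => [//|k IH] I P; apply/polyP => i.
by rewrite coef_hasse !coefCM IH coef_hasse mulrnAr.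
Qed.

Lemma bin_trinomial h l i :
  ('C(l + i, l) * 'C(h + l + i, h) = 'C(h + l, l) * 'C(h + l + i, h + l))%N.
Proof.
have F a b : ('C(a + b, a) * (a`! * b`!) = (a + b)`!)%N.
  by have := bin_fact (leq_addr b a); rewrite addKn.
have F' a b : ('C(a + b, b) * (a`! * b`!) = (a + b)`!)%N.
  by rewrite addnC [(a`! * _)%N]mulnC F.
apply/eqP; rewrite -(eqn_pmul2r (fact_gt0 h)) -(eqn_pmul2r (fact_gt0 l)).
rewrite -(eqn_pmul2r (fact_gt0 i)); apply/eqP.
have := F l i; have := F h (l + i)%N; have := F' h l; have := F (h + l)%N i.
rewrite addnA => e1 e2 e3 e4.
transitivity ((h + l + i)`!).
  by rewrite -e3 -e4; ring.
by rewrite -e1 -e2; ring.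
Qed.

Lemma nderivn_nderivn (A : nzRingType) (p : {poly A}) h l :
  p^`N(h)^`N(l) = p^`N(h + l) *+ 'C(h + l, l).
Proof.
apply/polyP => i; rewrite coefMn !coef_nderivn addnA -!mulrnA.
by congr (_ *+ _); rewrite mulnC bin_trinomial mulnC.
Qed.

Lemma nderivn_map_hasse (R : idomainType) k I (p : {poly mpol R k}) l :
  (map_poly (hasse R k I) p)^`N(l) = map_poly (hasse R k I) p^`N(l).
Proof. by apply/polyP => i; rewrite coef_nderivn !coef_map coef_nderivn raddfMn. Qed.

Lemma horner_map_hasse (R : idomainType) k I c (p : {poly mpol R k}) :
  (map_poly (hasse R k I) p).[mpolC R k c] = hasse R k I p.[mpolC R k c].
Proof.
rewrite (horner_coef_wide _ (size_poly _ _)) horner_coef raddf_sum.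
by apply: eq_bigr => i _; rewrite coef_map -rmorphXn /= mulrC -hasseCM mulrC.
Qed.

Lemma hasse_horner (R : idomainType) k I c (P : mpol R k.+1) l :
  (hasse R k.+1 I P : {poly mpol R k})^`N(l).[mpolC R k c] =
  hasse R k (behead I) ((P : {poly mpol R k})^`N(head 0%N I + l).[mpolC R k c])
    *+ 'C(head 0%N I + l, l).
Proof.
by rewrite /= nderivn_nderivn hornerMn nderivn_map_hasse horner_map_hasse.
Qed.

Section Index.
Variable R : realFieldType.
Variables (r : nat -> nat) (b : nat -> R).
Local Notation van := (vanishes r b).

Lemma vanishes_le k th th' (P : mpol R k) : th' <= th -> van th P -> van th' P.
Proof.
elim: k th th' P => [|k IH] th th' P hth hP; first by move=> /lt_le_trans/(_ hth)/hP.
by move=> l; apply: IH (hP l); rewrite lerB.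
Qed.

Lemma vanishes0 k th : van th (0 : mpol R k).
Proof. by elim: k th => [//|k IH] th l; rewrite raddf0 horner0; exact: IH. Qed.

Lemma vanishesD k th (P Q : mpol R k) : van th P -> van th Q -> van th (P + Q).
Proof.
elim: k th P Q => [|k IH] th P Q hP hQ; first by move=> h; rewrite hP ?hQ ?addr0.
by move=> l; rewrite raddfD hornerD; apply: IH.
Qed.

Lemma vanishes_sum k th (I : Type) (l : seq I) (A : pred I) (F : I -> mpol R k) :
  (forall i, A i -> van th (F i)) -> van th (\sum_(i <- l | A i) F i).
Proof. by move=> h; apply: (big_ind (van th)) => //; [exact: vanishes0|exact: vanishesD]. Qed.

Lemma vanishesM k th1 th2 (P Q : mpol R k) :
  van th1 P -> van th2 Q -> van (th1 + th2) (P * Q).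
Proof.
elim: k th1 th2 P Q => [|k IH] th1 th2 P Q hP hQ.
  move=> h; have [h1|h1] := ltP 0 th1; first by rewrite hP ?mul0r.
  by rewrite hQ ?mulr0 // (lt_le_trans h) // gerDr.
move=> l; rewrite horner_nderivnM; apply: vanishes_sum => i _.
apply: vanishes_le (IH _ _ _ _ (hP i) (hQ (l - i)%N)).
rewrite addrACA -opprD -mulrDl -natrD subnKC // -ltnS.
exact: ltn_ord.
Qed.

Lemma vanishes_le0 k th (P : mpol R k) : th <= 0 -> van th P.
Proof.
elim: k th P => [|k IH] th P hth; first by move=> /(le_lt_trans hth); rewrite ltxx.
by move=> l; apply: IH; rewrite (le_trans _ hth) // gerBl divr_ge0.
Qed.

Lemma vanishesCM k th c (P : mpol R k) : van th P -> van th (mpolC R k c * P).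
Proof. by move=> h; rewrite -[th]add0r; apply: vanishesM h; apply: vanishes_le0. Qed.

Lemma vanishes_prod k (I : Type) (l : seq I) (F : I -> mpol R k) (th : I -> R) :
  (forall i, van (th i) (F i)) -> van (\sum_(i <- l) th i) (\prod_(i <- l) F i).
Proof.
move=> h; elim: l => [|x l IH]; first by rewrite !big_nil; apply: vanishes_le0.
by rewrite !big_cons; apply: vanishesM.
Qed.

(** Every term of the determinant takes exactly one entry from each column, so the column orders add
    up. *)
Lemma vanishes_det k s (M : 'M[mpol R k]_s) (th : 'I_s -> R) :
  (forall i j, van (th j) (M i j)) -> van (\sum_j th j) (\det M).
Proof.
move=> hM; apply: vanishes_sum => t _.
have -> : (-1) ^+ t = mpolC R k ((-1) ^+ t) by rewrite rmorphXn /= rmorphN1.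
apply: vanishesCM; rewrite (reindex_inj (@perm_inj _ t)) /=.
by apply: vanishes_prod => i.
Qed.

Lemma vanishes_hasse k th I (P : mpol R k) :
  van th P -> van (th - mweight R r k I) (hasse R k I P).
Proof.
elim: k th I P => [|k IH] th I P hP; first by rewrite /= subr0.
move=> l; rewrite hasse_horner.
rewrite -[X in vanishes _ _ _ X]mulr_natl -(rmorph_nat (mpolC R k)).
apply: vanishesCM.
have /vanishes_le := IH _ (behead I) _ (hP (head 0%N I + l)%N); apply.
rewrite /= natrD mulrDl !opprD; set x := _ / _; set y := _ / _; set z := mweight _ _ _ _.
by rewrite -!addrA lerD2l lerD2l addrC.
Qed.

End Index.

(** * Separation of the last variable *)

Section Split.
Variable R : realFieldType.

Definition tens k s (phi : 'I_s -> mpol R k) (psi : 'I_s -> {poly R}) : {poly mpol R k} :=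
  \sum_t (phi t)%:P * map_poly (mpolC R k) (psi t).

Lemma tens_elimr k s (phi : 'I_s.+1 -> mpol R k) psi c j0 :
  \sum_j mpolC R k (c j) * phi j = 0 -> c j0 != 0 ->
  tens phi psi = tens (fun i => phi (lift j0 i))
    (fun i => psi (lift j0 i) - (c (lift j0 i) / c j0) *: psi j0).
Proof.
move=> E nz; rewrite /tens (bigD1_ord j0) //=.
have -> : phi j0 = - \sum_i mpolC R k (c (lift j0 i) / c j0) * phi (lift j0 i).
  move: E; rewrite (bigD1_ord j0) //= => /eqP; rewrite addr_eq0 => /eqP E.
  have /(congr1 ( *%R (mpolC R k (c j0)^-1))) := E.
  rewrite mulrA -rmorphM /= mulVf // rmorph1 mul1r => ->.
  rewrite mulrN mulr_sumr; congr (- _); apply: eq_bigr => i _.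
  by rewrite mulrA -rmorphM /= [_^-1 * _]mulrC.
rewrite rmorphN rmorph_sum mulNr mulr_suml addrC -sumrB.
apply: eq_bigr => i _; rewrite rmorphB mulrBr; congr (_ - _).
rewrite /= map_polyZ -mul_polyC mulrA; congr (_ * _).
by rewrite -polyCM mulrC.
Qed.

Lemma tens_eliml k s (phi : 'I_s.+1 -> mpol R k) psi c j0 :
  \sum_j c j *: psi j = 0 -> c j0 != 0 ->
  tens phi psi = tens (fun i => phi (lift j0 i) - mpolC R k (c (lift j0 i) / c j0) * phi j0)
    (fun i => psi (lift j0 i)).
Proof.
move=> E nz; rewrite /tens (bigD1_ord j0) //=.
have -> : psi j0 = - \sum_i (c (lift j0 i) / c j0) *: psi (lift j0 i).
  move: E; rewrite (bigD1_ord j0) //= => /eqP; rewrite addr_eq0 => /eqP E.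
  have /(congr1 ( *:%R (c j0)^-1)) := E.
  rewrite scalerA mulVf // scale1r => ->.
  rewrite scalerN scaler_sumr; congr (- _); apply: eq_bigr => i _.
  by rewrite scalerA mulrC.
rewrite rmorphN rmorph_sum mulrN mulr_sumr addrC -sumrB.
apply: eq_bigr => i _; rewrite rmorphB mulrBl; congr (_ - _).
rewrite /= map_polyZ -mul_polyC mulrA; congr (_ * _).
by rewrite -polyCM mulrC.
Qed.

(** A linear relation in either family lets one summand be absorbed by the others, so a
    decomposition that cannot be shortened in this way has both families independent. *)
Lemma tens_reduce k s (phi : 'I_s -> mpol R k) psi :
  exists s' (phi' : 'I_s' -> mpol R k) psi',
    [/\ (s' <= s)%N, tens phi psi = tens phi' psi', mindep phi' & lin_indep psi'].
Proof.
elim: s phi psi => [|s IH] phi psi.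
  by exists 0%N, phi, psi; split=> // c _ [].
have [h1|/existsNP [c /not_implyP [E /existsNP [j0 /eqP nz]]]] := pselect (mindep phi).
  have [h2|/existsNP [c /not_implyP [E /existsNP [j0 /eqP nz]]]] := pselect (lin_indep psi).
    by exists s.+1, phi, psi.
  rewrite (tens_eliml _ E nz).
  have [s' [p1 [p2 [hs h H1 H2]]]] := IH (fun i => phi (lift j0 i)
    - mpolC R k (c (lift j0 i) / c j0) * phi j0) (fun i => psi (lift j0 i)).
  by exists s', p1, p2; split=> //; apply: leqW.
rewrite (tens_elimr _ E nz).
have [s' [p1 [p2 [hs h H1 H2]]]] := IH (fun i => phi (lift j0 i))
  (fun i => psi (lift j0 i) - (c (lift j0 i) / c j0) *: psi j0).
by exists s', p1, p2; split=> //; apply: leqW.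
Qed.

Lemma tens_coef k (P : {poly mpol R k}) :
  P = tens (fun i : 'I_(size P) => P`_i) (fun i => 'X^i).
Proof.
rewrite -{1}[P]coefK poly_def /tens; apply: eq_bigr => i _.
by rewrite map_polyXn mul_polyC.
Qed.

Lemma hasse_tens k s (phi : 'I_s -> mpol R k) psi j I :
  hasse R k.+1 (j :: I) (tens phi psi : mpol R k.+1) =
  \sum_t (hasse R k I (phi t))%:P * map_poly (mpolC R k) (psi t)^`N(j).
Proof.
rewrite /tens raddf_sum; apply: eq_bigr => t _; apply/polyP => i.
rewrite coef_hasse [head _ _]/= [behead _]/= !coefCM !coef_map coef_nderivn /=.
by rewrite [phi t * _]mulrC hasseCM -mulrnAl -rmorphMn mulrC.
Qed.

Lemma hasse_univ (p : {poly R}) j : hasse R 1 [:: j] (p : mpol R 1) = p^`N(j).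
Proof. by rewrite /= map_poly_id. Qed.

(** Write [P] as a sum of s products phi_t psi_t with both families independent. The matrix of mixed
    derivatives is then the product of the Wronskian matrix of the phi_t and the transposed one of
    the psi_t; [U] and [V] are their determinants. Starting from the powers of the outer variable
    bounds s by [size P]. *)
Theorem wronskian_split k (P : mpol R k.+1) : P != 0 ->
  exists s (I : 'I_s -> seq nat) (J : 'I_s -> nat) (U : mpol R k) (V : {poly R}),
  [/\ (0 < s <= size (P : {poly mpol R k}))%N,
      forall i : 'I_s, size (I i) = k /\ (sumn (I i) <= i)%N,
      forall i : 'I_s, (J i <= i)%N, U != 0 /\ V != 0 &
      \det (\matrix_(i < s, j < s) hasse R k.+1 (J j :: I i) P) =
        U%:P * map_poly (mpolC R k) V].
Proof.
move=> nz; have char0 n : n.+1%:R != 0 :> R by rewrite pnatr_eq0.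
have [s [phi [psi [hs E li1 li2]]]] :=
  tens_reduce (fun i : 'I_(size (P : {poly mpol R k})) => (P : {poly mpol R k})`_i)
    (fun i => 'X^i).
rewrite -tens_coef in E.
have [I [hI dI]] := generalized_wronskian char0 li1.
(* [{poly R}] is read as [mpol R 1], so that the same theorem serves both families. *)
have li2' : mindep (k := 1) psi.
  by move=> c Ec; apply: li2; rewrite -[RHS]Ec; apply: eq_bigr => t _; rewrite -mul_polyC.
have [J [hJ dJ]] := generalized_wronskian char0 li2'.
exists s, I, (fun j => head 0%N (J j)), (\det (\matrix_(i, j) hasse R k (I i) (phi j))),
  (\det (\matrix_(i, j) hasse R 1 (J i) (psi j))); split=> //.
- rewrite hs andbT lt0n; apply: contraNneq nz => s0; rewrite E /tens.
  by apply/eqP; apply: big1 => i _; have := ltn_ord i; rewrite [X in (_ < X)%N]s0.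
- by move=> i; have [] := hJ i; case: (J i) => [|a [|]] //= _; rewrite addn0.
rewrite -det_map_mx -det_map_mx -[X in _ * X]det_tr -det_mulmx; congr (\det _).
apply/matrixP => i j; rewrite !mxE E hasse_tens; apply: eq_bigr => t _.
rewrite !mxE; congr (_ * map_poly _ _); have [+ _] := hJ j.
by case: (J j) => [|a [|]] //= _; rewrite -hasse_univ.
Qed.

End Split.

(** * Roth's lemma *)

Section GaussBound.
Variable R : archiRealFieldType.
Implicit Types (p : int) (q : nat) (V S Q : {poly R}).
Local Notation isint V := (@mint R 1 V).

Lemma coprime_int_pow p q m n (x : R) : coprimez p q ->
  p%:~R ^+ m * x \is a Num.int -> q%:R ^+ n * x \is a Num.int -> x \is a Num.int.
Proof.
move=> cpq hp hq; have /coprimezP [[u v] /= uv] : coprimez (p ^+ m) (q%:Z ^+ n).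
  by rewrite coprimezXl // coprimezXr.
have -> : x = u%:~R * (p%:~R ^+ m * x) + v%:~R * (q%:R ^+ n * x).
  rewrite !mulrA -mulrDl -[LHS]mul1r; congr (_ * _).
  have := congr1 (fun z : int => z%:~R : R) uv.
  by rewrite rmorphD !rmorphM !rmorphXn.
by apply: rpredD; apply: rpredM => //; apply: intr_int.
Qed.

(** Solving for the coefficients of [Q] from the constant term upwards leaves only powers of p in
    the denominators; from the top downwards, only powers of q. As p and q are coprime, there are no
    denominators. *)
Lemma int_linear_factor p q Q : coprimez p q ->
  isint ((q%:R *: 'X - (p%:~R)%:P) * Q) -> isint Q.
Proof.
move=> cpq hV; set V := _ * Q in hV.
have V0 : V`_0 = - (p%:~R * Q`_0).
  by rewrite /V mulrBl coefB -scalerAl coefZ coefXM mulr0 coefCM sub0r.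
have VS i : V`_i.+1 = q%:R * Q`_i - p%:~R * Q`_i.+1.
  by rewrite /V mulrBl coefB -scalerAl coefZ coefXM coefCM.
have up i : p%:~R ^+ i.+1 * Q`_i \is a Num.int.
  elim: i => [|i IH]; first by have := hV 0%N; rewrite V0 rpredN.
  have -> : p%:~R ^+ i.+2 * Q`_i.+1 = q%:R * (p%:~R ^+ i.+1 * Q`_i) - p%:~R ^+ i.+1 * V`_i.+1.
    by rewrite VS (exprS _ i.+1); ring.
  by rewrite rpredB // rpredM ?rpredX ?natr_int ?intr_int //; exact: hV.
have down m i : (size Q <= i + m)%N -> q%:R ^+ m * Q`_i \is a Num.int.
  elim: m i => [|m IH] i hi; first by rewrite nth_default ?mulr0 // -[i]addn0.
  have -> : q%:R ^+ m.+1 * Q`_i = q%:R ^+ m * V`_i.+1 + p%:~R * (q%:R ^+ m * Q`_i.+1).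
    by rewrite VS (exprS _ m); ring.
  rewrite rpredD // rpredM ?rpredX ?natr_int ?intr_int //; first exact: hV.
  by apply: IH; rewrite addSnnS.
move=> i; exact: coprime_int_pow cpq (up i) (down _ _ (leq_addl i (size Q))).
Qed.

Lemma int_linear_factors p q n S : (0 < q)%N -> coprimez p q ->
  isint (('X - (p%:~R / q%:R)%:P) ^+ n * S) -> isint ((q%:R ^- n) *: S).
Proof.
move=> q0 cpq; elim: n S => [|n IH] S; first by rewrite expr0 mul1r invr1 scale1r.
have qn0 : q%:R != 0 :> R by rewrite pnatr_eq0 -lt0n.
rewrite exprS => h; rewrite exprSr invfM -scalerA; apply: IH.
rewrite -scalerAr; apply: (int_linear_factor cpq).
suff -> : (q%:R *: 'X - (p%:~R)%:P) * (q%:R^-1 *: (('X - (p%:~R / q%:R)%:P) ^+ n * S))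
   = ('X - (p%:~R / q%:R)%:P) * ('X - (p%:~R / q%:R)%:P) ^+ n * S by [].
rewrite -scalerAr scalerAl mulrA; congr (_ * _ * _).
by rewrite scalerBr scalerA mulVf // scale1r -mul_polyC -polyCM mulrC.
Qed.

Lemma mnorm_ge1 k (P : mpol R k) : mint P -> P != 0 -> 1 <= mnorm P.
Proof.
move=> hP /mcoef_neq0 [I nz]; apply: le_trans (mcoef_norm I P).
exact: norm_intr_ge1 (mcoef_int I hP) nz.
Qed.

Lemma dvdp_vanishing (F : fieldType) (V : {poly F}) c n :
  (forall l, (l < n)%N -> V^`N(l).[c] = 0) -> ('X - c%:P) ^+ n %| V.
Proof.
move=> h; have E : V = (V \Po ('X + c%:P)) \Po ('X - c%:P).
  by rewrite -comp_polyA comp_polyD comp_polyX comp_polyC subrK comp_polyXr.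
rewrite E; set W := V \Po _.
have -> : W = drop_poly n W * 'X^n.
  rewrite -[LHS](poly_take_drop n W) [take_poly n W](_ : _ = 0) ?add0r //.
  by apply/polyP => i; rewrite coef0 coef_take_poly; case: ifP => // /h; rewrite coef_comp_XaddC.
by rewrite comp_polyM comp_Xn_poly; apply: dvdp_mull.
Qed.

(** [V] is (qX - p)^n times an integral polynomial, so q^n divides its leading coefficient. *)
Lemma gauss_bound p q n V : (0 < q)%N -> coprimez p q -> isint V -> V != 0 ->
  (forall l, (l < n)%N -> V^`N(l).[p%:~R / q%:R] = 0) -> q%:R ^+ n <= @mnorm R 1 V.
Proof.
move=> q0 cpq hV nz /dvdp_vanishing/dvdpP [S E].
have qn0 : q%:R ^+ n != 0 :> R by rewrite expf_neq0 // pnatr_eq0 -lt0n.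
have hT : isint (q%:R ^- n *: S) by apply: int_linear_factors cpq _ => //; rewrite mulrC -E.
have Snz : S != 0 by apply: contraNneq nz => S0; rewrite E S0 mul0r.
have lcV : lead_coef V = lead_coef S by rewrite E lead_coef_Mmonic // monic_exp // monicXsubC.
apply: le_trans (_ : `|lead_coef V| <= _); last exact: (mnorm_coef (V : mpol R 1) _).
have -> : lead_coef V = q%:R ^+ n * lead_coef (q%:R ^- n *: S).
  by rewrite lead_coefZ mulrA divff // mul1r lcV.
rewrite normrM ger0_norm ?exprn_ge0 // ler_peMr ?exprn_ge0 //.
apply: norm_intr_ge1; first exact: hT.
by rewrite lead_coef_eq0 scaler_eq0 invr_eq0 negb_or qn0.
Qed.

End GaussBound.

Section RothLemma.
Variable R : realType.

Lemma mweight_le (r : nat -> nat) k I c : (0 < c)%N -> (forall h, (h < k)%N -> (c <= r h)%N) ->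
  mweight R r k I <= (sumn I)%:R / c%:R.
Proof.
move=> c0; elim: k I => [|k IH] I hr; first by rewrite divr_ge0.
have hc : 0 < c%:R :> R by rewrite ltr0n.
apply: (@le_trans _ _ ((head 0%N I)%:R / c%:R + (sumn (behead I))%:R / c%:R)).
  apply: lerD; last by apply: IH => h hh; rewrite hr // ltnW.
  by rewrite ler_wpM2l // lef_pV2 ?posrE ?ltr0n ?ler_nat ?(leq_trans c0) ?hr.
by rewrite -mulrDl -natrD; case: I.
Qed.

(** The j-th summand will be the order kept by the j-th column of the Wronskian. The indices j <=
    eps r / 2 form at least a proportion eps / 4 of all s, and each contributes at least eps / 2 -
    om; the others contribute at least 0. *)
Lemma sum_truncated_ge (eps om : R) (r s : nat) : 0 < eps <= 1 -> (0 < r)%N -> (s <= r.+1)%N ->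
  0 <= om ->
  s%:R * (eps ^+ 2 / 8 - om) <= \sum_(j < s) Num.max 0 (eps - j%:R / r%:R - om).
Proof.
move=> /andP[e0 e1] r0 hs om0; have hr : 0 < r%:R :> R by rewrite ltr0n.
pose x := eps * r%:R / 2; have x0 : 0 <= x.
  by rewrite /x divr_ge0 // mulr_ge0 // ltW.
have [xl xu] := andP (truncn_itv x0).
pose m := minn s (Num.truncn x).+1.
apply: (@le_trans _ _ (\sum_(j < s) ((if (j < m)%N then eps / 2 else 0) - om))).
  rewrite sumrB sumr_const card_ord -big_mkcond /=.
  rewrite -(big_ord_widen s (fun _ => eps / 2)) ?geq_minl // sumr_const card_ord.
  rewrite mulrBr -[om *+ s]mulr_natl lerB // -[_ *+ m]mulr_natl.
  suff h : s%:R * eps / 4 <= m%:R.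
    have /ler_wpM2r/(_ _ _ h) : 0 <= eps / 2 by lra.
    by rewrite expr2; lra.
  rewrite /m; case: (leqP s (Num.truncn x).+1) => hm.
    have : 0 <= s%:R :> R by [].
    move=> s0; have : s%:R * eps <= s%:R * 1 :> R by apply: ler_wpM2l.
    by lra.
  have hs' : s%:R <= r%:R + 1 :> R by rewrite -(natrD _ r 1) ler_nat addn1.
  have h1 : 1 <= (Num.truncn x).+1%:R :> R by rewrite ler1n.
  have : s%:R * eps <= (r%:R + 1) * eps by apply: ler_wpM2r => //; exact: ltW.
  by rewrite /x in xu; lra.
apply: ler_sum => j _; case: ifP => hj; last first.
  rewrite sub0r; apply: le_trans (_ : 0 <= _); first by rewrite oppr_le0.
  by rewrite le_max lexx.
rewrite le_max; apply/orP; right; rewrite lerB // lerBrDr -lerBrDl.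
have hjx : j%:R <= x.
  apply: le_trans xl; rewrite ler_nat; move: hj; rewrite /m leq_min => /andP[_].
  by rewrite ltnS.
rewrite ler_pdivrMr //; rewrite /x in hjx; nra.
Qed.

Lemma roth_lemma_univ (eps : R) (r : nat) (p : int) (q : nat) (V : {poly R}) :
  0 < eps -> (0 < r)%N -> (1 < q)%N -> coprimez p q -> @mint R 1 V -> V != 0 ->
  ln (@mnorm R 1 V) <= eps / 2 * r%:R * ln q%:R ->
  ~ vanishes (fun _ => r) (fun _ => p%:~R / q%:R) eps (V : mpol R 1).
Proof.
move=> e0 r0 q1 cpq hV nz hn van; have hr : 0 < r%:R :> R by rewrite ltr0n.
have lnq : 0 < ln q%:R :> R by rewrite ln_gt0 // ltr1n.
pose n := (Num.truncn (eps * r%:R / 2)).+1.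
have x0 : 0 <= eps * r%:R / 2 by rewrite divr_ge0 // mulr_ge0 // ltW.
have [xl xu] := andP (truncn_itv x0).
have : q%:R ^+ n <= @mnorm R 1 V.
  apply: (gauss_bound (p := p)) => //; first exact: ltnW.
  move=> l; rewrite /n ltnS => hl; apply: (van l); rewrite subr_gt0 ltr_pdivrMr //.
  have : l%:R <= (Num.truncn (eps * r%:R / 2))%:R :> R by rewrite ler_nat.
  have : 0 < eps * r%:R by rewrite mulr_gt0.
  lra.
rewrite -ler_ln ?posrE ?exprn_gt0 ?ltr0n ?(ltnW q1) //; last first.
  exact: lt_le_trans (mnorm_ge1 (k := 1) hV nz).
rewrite lnXn ?ltr0n ?(ltnW q1) // -[X in X <= _]mulr_natl => /le_trans/(_ hn).
rewrite ler_pM2r // => h; move: xu; rewrite -/n ltNge => /negP; apply.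
by rewrite (le_trans h) // mulrAC.
Qed.

(** A determinant of size s has degrees [s * r h]. Measured with these degrees, its index is divided
    by s, as the induction in Roth's lemma requires. *)
Lemma vanishes_scale (r : nat -> nat) b k th s (P : mpol R k) : (0 < s)%N ->
  vanishes r b (s%:R * th) P -> vanishes (fun h => (s * r h)%N) b th P.
Proof.
move=> s0; have hs : 0 < s%:R :> R by rewrite ltr0n.
elim: k th P => [|k IH] th P hP; first by move=> h; apply: hP; rewrite mulr_gt0.
move=> l; apply: IH; rewrite mulrBr natrM invfM.
suff -> : s%:R * (l%:R * (s%:R^-1 * (r k)%:R^-1)) = l%:R / (r k)%:R :> R by apply: hP.
by rewrite mulrCA mulVKf // lt0r_neq0.
Qed.

Lemma fact_le_exp n N : (n <= N)%N -> (n`! <= N ^ n)%N.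
Proof.
elim: n => [//|n IH] h; rewrite factS expnS leq_mul // IH //; exact: ltnW.
Qed.

Lemma ln2_le1 : ln 2%:R <= 1 :> R.
Proof. by have := @le_ln1Dx R 1; rewrite -(natrD _ 1 1); apply; lra. Qed.

(** The factorial is at most [(2 ^ N) ^ s], so it costs [N] per row, like the binomial factors of
    the derivatives. *)
Lemma ln_mnorm_det (r : nat -> nat) k (P : mpol R k) N s (M : 'I_s -> 'I_s -> seq nat) :
  mint P -> P != 0 -> mdeg r P -> (s <= 2 ^ N)%N ->
  \det (\matrix_(i < s, j < s) hasse R k (M i j) P) != 0 ->
  ln (mnorm (\det (\matrix_(i < s, j < s) hasse R k (M i j) P)))
    <= s%:R * ((N + \sum_(h < k) r h)%:R + ln (mnorm P)).
Proof.
move=> hP nz dP hs dnz; set W := \det _; set S := (\sum_(h < k) r h)%N.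
have P1 := mnorm_ge1 hP nz; have P0 := lt_le_trans ltr01 P1.
have hW : mnorm W <= s`!%:R * (2%:R ^+ S * mnorm P) ^+ s.
  by apply: mnorm_det => i j; rewrite mxE mnorm_hasse.
have W1 : 1 <= mnorm W.
  by apply: mnorm_ge1 dnz; apply: mint_det => i j; rewrite mxE; apply: mint_hasse.
have hW' : mnorm W <= (2%:R ^+ (N + S) * mnorm P) ^+ s.
  apply: le_trans hW _; rewrite exprD -[in leRHS]mulrA [in leRHS]exprMn.
  rewrite ler_wpM2r ?exprn_ge0 ?mulr_ge0 ?exprn_ge0 ?(ltW P0) //.
  rewrite -natrX -natrX ler_nat fact_le_exp //.
have R0 : 0 < 2%:R ^+ (N + S) * mnorm P by rewrite mulr_gt0 // exprn_gt0.
have : ln (mnorm W) <= ln ((2%:R ^+ (N + S) * mnorm P) ^+ s).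
  by rewrite ler_ln // posrE ?exprn_gt0 // (lt_le_trans ltr01).
move/le_trans; apply; rewrite lnXn ?mulr_gt0 ?exprn_gt0 // -[leLHS]mulr_natl ler_wpM2l //.
rewrite lnM ?posrE ?exprn_gt0 // lerD2r lnXn // -[leLHS]mulr_natl ler_piMr //.
exact: ln2_le1.
Qed.

(** The roles of the smallness conditions: [r h.+1 <= om * r h] makes derivatives in the earlier
    variables cheap; [1 <= om * ln (q 0)] lets factors exponential in the degrees be absorbed; the
    minimality of [r 0 * ln (q 0)] lets one norm bound serve every variable. *)
Theorem roth_lemma k (eps : R) : 0 < eps -> exists2 om : R, 0 < om <= 1 &
  forall (r : nat -> nat) (p : nat -> int) (q : nat -> nat),
  (forall h, (h < k.+1)%N -> [/\ (0 < r h)%N, (1 < q h)%N, coprimez (p h) (q h) &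
     (r 0%N)%:R * ln (q 0%N)%:R <= (r h)%:R * ln (q h)%:R :> R]) ->
  (forall h, (h < k)%N -> (r h.+1)%:R <= om * (r h)%:R) ->
  1 <= om * ln (q 0%N)%:R ->
  forall P : mpol R k.+1, P != 0 -> mint P -> mdeg r P ->
  ln (mnorm P) <= om * ((r 0%N)%:R * ln (q 0%N)%:R) ->
  ~ vanishes r (fun h => (p h)%:~R / (q h)%:R) eps P.
Proof.
elim: k eps => [|k IH] eps0 eps0_gt0.
  exists (Num.min 1 (eps0 / 2)); first by rewrite lt_min ge_min lexx ltr01 divr_gt0.
  move=> r p q /(_ 0%N isT) [r0 q1 cpq _] _ _ P nz hP dP hn van.
  apply: (roth_lemma_univ eps0_gt0 r0 q1 cpq hP nz) van.
  apply: le_trans hn _; rewrite mulrA.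
  have lnq : 0 < ln (q 0%N)%:R :> R by rewrite ln_gt0 // ltr1n.
  by rewrite (ler_wpM2r (ltW lnq)) // ler_wpM2r // ge_min lexx orbT.
wlog eps1 : eps0 eps0_gt0 / eps0 <= 1.
  move=> H; have [|] := leP eps0 1; first exact: H.
  move=> h; have [|//|om hom H'] := H 1 _ _; first exact: ltr01.
  exists om => // r p q h1 h2 h3 P nz hP dP hn van.
  by apply: (H' r p q h1 h2 h3 P nz hP dP hn); apply: vanishes_le van; apply: ltW.
rename eps0 into eps, eps0_gt0 into e0.
(* The Wronskian has index at least s (eps^2 / 8 - om), hence at least 2 s e'; the contradiction
   comes from allowing less than s e' to each of [U] and [V]. *)
pose e' := eps ^+ 2 / 64.
have e'0 : 0 < e' by rewrite divr_gt0 // exprn_gt0.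
have [om' /andP[om'0 om'1] IH'] := IH _ e'0.
(* c / 2 = k + 5 counts multiples of om r_0 ln q_0 in the bound on ln of the norm of [W], per row: k
   + 2 for the degrees, one for the factorial, one for [P], one spare. The factor 2 is for the bound
   e' / 2 of the univariate case. *)
pose c : R := 2 * (k.+2 + 3)%:R.
have c1 : 1 <= c.
  by rewrite /c -natrM ler1n.
pose om := Num.min (eps ^+ 2 / 32) (Num.min (om' / c) (e' / 2 / c)).
have c0 : 0 < c by apply: lt_le_trans c1.
have om0 : 0 < om by rewrite !lt_min !divr_gt0 // exprn_gt0.
have om_e : om <= eps ^+ 2 / 32 by rewrite ge_min lexx.
have om_om' : om * c <= om' by rewrite -ler_pdivlMr // !ge_min lexx orbT.
have om_e' : om * c <= e' / 2 by rewrite -ler_pdivlMr // !ge_min lexx !orbT.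
have om_le : om <= om'.
  by apply: le_trans om_om'; rewrite ler_peMr // ltW.
have om1 : om <= 1 by apply: le_trans om_le om'1.
exists om; first by rewrite om0.
move=> r p q hh hr hq P nz hP dP hn van.
have [r00 q01 _ _] := hh 0%N isT.
set rk := r k.+1; have [rk0 qk1 cpqk lnk] := hh k.+1 (leqnn _).
have rS h : (h < k.+1)%N -> (r h.+1 <= r h)%N.
  by move=> hk; rewrite -(ler_nat R) (le_trans (hr h hk)) // ler_piMl.
have r_anti i j : (i <= j)%N -> (j <= k.+1)%N -> (r j <= r i)%N.
  move=> /subnK <-; elim: (j - i)%N => [//|n IHn] hn'.
  by rewrite addSn (leq_trans (rS _ _)) // IHn // ltnW.
have lnq0 : 0 < ln (q 0%N)%:R :> R by rewrite ln_gt0 // ltr1n.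
have [s [I [J [U [V [/andP[s0 hs] hI hJ [Unz Vnz] EW]]]]]] := wronskian_split nz.
have hsr : (s <= rk.+1)%N by apply: leq_trans hs _; case: dP.
set W := \det _ in EW.
have Wnz : W != 0.
  by rewrite EW mulf_neq0 ?polyC_eq0 // map_poly_eq0.
have Wint : mint W.
  by apply: mint_det => i j; rewrite mxE; apply: mint_hasse.
have Wdeg : mdeg (fun h => s * r h)%N W.
  by apply: mdeg_det => i j; rewrite mxE; apply: mdeg_hasse.
have s0' : 0 < s%:R :> R by rewrite ltr0n.
have Wn : ln (mnorm W) <= (s * r 0%N)%:R * (om * c / 2 * ln (q 0%N)%:R).
  have hs2 : (s <= 2 ^ r 0%N)%N.
    apply: leq_trans hsr _; apply: leq_ltn_trans (r_anti 0%N k.+1 (leq0n _) (leqnn _)) _.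
    exact: ltn_expl.
  apply: le_trans (ln_mnorm_det hP nz dP hs2 Wnz) _.
  rewrite natrM -mulrA ler_wpM2l //.
  have hS : (\sum_(h < k.+2) r h <= k.+2 * r 0%N)%N.
    rewrite -[X in (_ <= X * _)%N]card_ord -sum_nat_const leq_sum // => h _.
    by apply: r_anti; rewrite // -ltnS.
  have : (r 0%N + \sum_(h < k.+2) r h)%:R <= (k.+2 + 1)%:R * (r 0%N)%:R :> R.
    by rewrite -natrM ler_nat mulnDl mul1n addnC leq_add2r.
  move=> h; apply: le_trans (lerD h hn) _.
  have {}h : (k.+2 + 1)%:R * (r 0%N)%:R <=
      (k.+2 + 1)%:R * (r 0%N)%:R * (om * ln (q 0%N)%:R) :> R by rewrite ler_peMr ?mulr_ge0.
  apply: le_trans (lerD h (lexx _)) _.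
  have Ec : c / 2 = (k.+2 + 1)%:R + 2 by rewrite /c !natrD; field.
  rewrite -[om * c / 2]mulrA Ec -subr_ge0.
  rewrite (_ : _ - _ = om * ((r 0%N)%:R * ln (q 0%N)%:R)); last by ring.
  by rewrite mulr_ge0 ?mulr_ge0 // ltW.
pose b h : R := (p h)%:~R / (q h)%:R.
(* A coefficient of [W] in the last variable is an integral polynomial and a
   scalar multiple of [U]: it is under the control of the induction hypothesis. *)
have vU : ~ vanishes (fun h => (s * r h)%N) b e' U.
  have [n hn0] : exists n, V`_n != 0.
    by exists (size V).-1; rewrite -lead_coefE lead_coef_eq0.
  have EU : (W : {poly _})`_n = U * mpolC R k.+1 V`_n.
    by rewrite EW coefCM coef_map.
  have U'nz : (W : {poly mpol R k.+1})`_n != 0.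
    by rewrite EU mulf_neq0 // fmorph_eq0.
  move=> vU; apply: (IH' (fun h => (s * r h)%N) p q _ _ _ (W : {poly mpol R k.+1})`_n) => //.
  - move=> h hk; have [rh0 qh1 cpqh lnh] := hh h (ltnW hk).
    by split; rewrite ?muln_gt0 ?s0 // !natrM -!mulrA ler_wpM2l.
  - move=> h hk; rewrite !natrM mulrCA ler_wpM2l //.
    by rewrite (le_trans (hr h (ltnW hk))) // ler_wpM2r.
  - by rewrite (le_trans hq) // ler_wpM2r // ltW.
  - by case: Wdeg => _; apply.
  - have h1 : ln (mnorm (W : {poly mpol R k.+1})`_n) <= ln (mnorm W).
      rewrite ler_ln ?mnorm_coef // posrE; apply: lt_le_trans ltr01 _; apply: mnorm_ge1 => //.
    apply: le_trans h1 (le_trans Wn _).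
    rewrite [leRHS]mulrCA ler_wpM2l // (ler_wpM2r (ltW lnq0)) //.
    have : 0 < om * c by rewrite mulr_gt0.
    by lra.
  - by rewrite EU mulrC; apply: vanishesCM.
(* Likewise for [V], with a coefficient of [W] in the first variables. *)
have [l [hl Vl]] : exists l, l%:R / rk%:R < s%:R * e' /\ V^`N(l).[b k.+1] != 0.
  have [I0 hI0] := mcoef_neq0 Unz.
  pose V' : {poly R} := mcoef I0 U *: V.
  have V'E n : V'`_n = mcoef I0 (W : {poly mpol R k.+1})`_n.
    by rewrite EW coefCM coef_map mcoefMC coefZ.
  have V'nz : V' != 0 by rewrite scaler_eq0 negb_or hI0.
  have V'int : @mint R 1 V' by move=> n; rewrite V'E; apply: mcoef_int; apply: Wint.
  have V'n : @mnorm R 1 V' <= mnorm W.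
    have szV : (size V' <= size (W : {poly mpol R k.+1}))%N.
      by apply/leq_sizeP => j hj; rewrite V'E nth_default ?mcoef0.
    rewrite (@mnormE _ 0 V' _ szV); apply: ler_sum => i _.
    by rewrite V'E; apply: mcoef_norm.
  apply: contrapT => H.
  have srk : (0 < s * rk)%N by rewrite muln_gt0 s0.
  apply: (roth_lemma_univ e'0 srk qk1 cpqk V'int V'nz).
    have h1 : ln (@mnorm R 1 V') <= ln (mnorm W).
      by rewrite ler_ln // posrE (lt_le_trans ltr01) // mnorm_ge1.
    apply: le_trans h1 (le_trans Wn _).
    set l0 := ln (q 0%N)%:R in lnk lnq0 *; set l1 := ln (q k.+1)%:R in lnk *.
    rewrite !natrM [leLHS](_ : _ = s%:R * (om * c / 2 * ((r 0%N)%:R * l0))); last by ring.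
    rewrite [leRHS](_ : _ = s%:R * (e' / 2 * (rk%:R * l1))); last by ring.
    have omc0 : 0 < om * c by rewrite mulr_gt0.
    rewrite ler_wpM2l // ler_pM ?mulr_ge0 ?(ltW lnq0) //; lra.
  move=> l /=; rewrite subr_gt0 natrM invfM mulrCA ltr_pdivrMl // => hl.
  rewrite nderivnZ hornerZ; apply/eqP; rewrite mulf_eq0 (negPf hI0) /=.
  by apply/negPn/negP => H'; apply: H; exists l.
have vW : vanishes r b (s%:R * (2 * e')) W.
  pose th (j : 'I_s) := Num.max 0 (eps - j%:R / rk%:R - om).
  apply: vanishes_le (_ : vanishes r b (\sum_j th j) W).
    have eps01 : 0 < eps <= 1 by rewrite e0.
    apply: le_trans (sum_truncated_ge eps01 rk0 hsr (ltW om0)).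
    rewrite ler_wpM2l // /e'; lra.
  apply: vanishes_det => i j; rewrite mxE /th; case: leP => _; last exact: vanishes_le0.
  apply: vanishes_le (vanishes_hasse (J j :: I i) van).
  have [szI sumI] := hI i.
  rewrite /= opprD addrA; apply: lerB.
    by rewrite lerD2l lerN2 ler_wpM2r ?invr_ge0 // ler_nat hJ.
  (* Derivatives in the first variables have total order below s, hence at most r_(k+1), and each
     unit of order costs at most 1 / r_k: the loss is at most om. *)
  have rk'0 : (0 < r k)%N by case: (hh k (leqnSn _)).
  have hc h : (h < k.+1)%N -> (r k <= r h)%N by move=> hk; rewrite r_anti // -ltnS.
  have := mweight_le (I i) rk'0 hc; rewrite /= => /le_trans; apply.
  rewrite ler_pdivrMr ?ltr0n //; apply: le_trans (hr k (leqnn _)).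
  by rewrite ler_nat (leq_trans sumI) // -ltnS (leq_trans (ltn_ord i)).
apply: vU; apply: vanishes_scale => //.
(* The l-th derivative of [W] in the last variable, at the last coordinate, is [U] times a nonzero
   scalar, so [U] inherits the index 2 s e' - l / r_(k+1), which is more than s e'. *)
have h : vanishes r b (s%:R * (2 * e') - l%:R / rk%:R)
    (U * mpolC R k.+1 V^`N(l).[b k.+1]).
  suff -> : U * mpolC R k.+1 V^`N(l).[b k.+1] =
      (W : {poly mpol R k.+1})^`N(l).[mpolC R k.+1 (b k.+1)] by exact: vW.
  by rewrite EW mul_polyC nderivnZ hornerZ nderivn_map horner_map.
have {h} := vanishesCM (V^`N(l).[b k.+1])^-1 h.
rewrite [X in vanishes _ _ _ X]mulrCA -(rmorphM (mpolC R k.+1)) mulVf // rmorph1 mulr1 => h.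
by apply: vanishes_le h; lra.
Qed.

End RothLemma.

(** * The auxiliary polynomial *)

Fixpoint box (r : nat -> nat) k : seq (seq nat) :=
  if k is k'.+1 then [seq l :: J | l <- iota 0 (r k').+1, J <- box r k'] else [:: [::]].

Section Box.
Variable r : nat -> nat.

Lemma boxS k : box r k.+1 = [seq l :: J | l <- iota 0 (r k).+1, J <- box r k].
Proof. by []. Qed.

Lemma big_box (V : nmodType) k (F : seq nat -> V) :
  \sum_(I <- box r k.+1) F I = \sum_(l < (r k).+1) \sum_(I <- box r k) F (nat_of_ord l :: I).
Proof.
have e : iota 0 (r k).+1 = index_iota 0 (r k).+1 by rewrite /index_iota subn0.
by rewrite boxS big_allpairs_dep e big_mkord.
Qed.

Lemma mem_boxS k l J : (l :: J \in box r k.+1) = (l <= r k)%N && (J \in box r k).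
Proof.
rewrite boxS; apply/idP/andP => [/allpairsP [[i I] [hi hI [-> ->]]]|[hl hJ]].
  by move: hi hI; rewrite mem_iota.
by apply/allpairsP; exists (l, J); rewrite mem_iota.
Qed.

Lemma boxP k J : J \in box r k -> size J = k /\ (sumn J <= \sum_(h < k) r h)%N.
Proof.
elim: k J => [|k IH] J; first by rewrite inE => /eqP ->; rewrite big_ord0.
case: J => [|l J]; first by rewrite boxS => /allpairsP [[i I] [_ _]].
rewrite mem_boxS => /andP[hl /IH [e hJ]]; split=> /=; first by rewrite e.
by rewrite big_ord_recr /= addnC leq_add.
Qed.

Lemma box_uniq k : uniq (box r k).
Proof.
elim: k => [//|k IH]; rewrite boxS; apply: allpairs_uniq => //; first exact: iota_uniq.
by move=> [a b] [c d] _ _ /= [-> ->].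
Qed.

Lemma size_box k : (0 < size (box r k) <= 2 ^ (\sum_(h < k) r h))%N.
Proof.
elim: k => [|k /andP[h1 h2]]; first by rewrite big_ord0.
rewrite boxS size_allpairs size_iota muln_gt0 h1 /= big_ord_recr /= addnC expnD leq_mul //.
exact: ltn_expl.
Qed.
End Box.

(** * Concentration of the weights of monomials *)

Section Chebyshev.
Variable R : realFieldType.
Variable r : nat -> nat.

Lemma sum_deviation n : (0 < n)%N -> \sum_(l < n.+1) (l%:R / n%:R - 2^-1) = 0 :> R.
Proof.
move=> n0; have hn : n%:R != 0 :> R by rewrite pnatr_eq0 -lt0n.
rewrite sumrB -mulr_suml sumr_const card_ord -natr_sum.
have -> : (\sum_(l < n.+1) l = 'C(n.+1, 2))%N by rewrite -bin2_sum big_mkord.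
have /(congr1 (fun k => k%:R : R)) : ('C(n.+1, 2) * 2 = n.+1 * n)%N.
  by rewrite mulnC mul_bin_left bin1 subSS subn0 mulnC.
rewrite !natrM => E; rewrite -[X in _ - X]mulr_natl.
have -> : 'C(n.+1, 2)%:R = n.+1%:R * n%:R / 2 :> R by rewrite -E mulfK ?pnatr_eq0.
by rewrite mulrAC mulfK // subrr.
Qed.

Lemma deviation_sqr n l : (0 < n)%N -> (l <= n)%N -> (l%:R / n%:R - 2^-1) ^+ 2 <= 4^-1 :> R.
Proof.
move=> n0 hl; have hn : 0 < n%:R :> R by rewrite ltr0n.
have h0 : 0 <= l%:R / n%:R :> R by rewrite divr_ge0.
have h1 : l%:R / n%:R <= 1 :> R by rewrite ler_pdivrMr // mul1r ler_nat.
by rewrite expr2; nra.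
Qed.

Lemma sum_sqr_shift (T : Type) (s : seq T) (y : T -> R) (z : R) : \sum_(I <- s) y I = 0 ->
  \sum_(I <- s) (z ^+ 2 + 2 * z * y I + y I ^+ 2) =
  z ^+ 2 * (size s)%:R + \sum_(I <- s) y I ^+ 2.
Proof.
move=> E; rewrite !big_split /= [X in _ + X + _](_ : _ = 0); last by rewrite -mulr_sumr E mulr0.
by rewrite addr0 big_const_seq count_predT iter_addr_0 mulr_natr.
Qed.

(** For a uniformly random multi-index the weight is a sum of k independent variables in [0, 1] of
    mean 1/2, each of variance at most 1/4. Independence appears as the vanishing of the cross
    terms. *)
Lemma box_moments k : (forall h, (h < k)%N -> (0 < r h)%N) ->
  \sum_(I <- box r k) (mweight R r k I - k%:R / 2) = 0 /\
  \sum_(I <- box r k) (mweight R r k I - k%:R / 2) ^+ 2 <= (size (box r k))%:R * k%:R / 4.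
Proof.
elim: k => [|k IH] hr.
  by rewrite !big_seq1 /= mul0r subr0 expr0n mulr0 mul0r.
have [E1 E2] := IH (fun h hh => hr h (ltnW hh)); have rk := hr k (leqnn _).
pose y (I : seq nat) : R := mweight R r k I - k%:R / 2.
have {}E1 : \sum_(I <- box r k) y I = 0 := E1.
have {}E2 : \sum_(I <- box r k) y I ^+ 2 <= (size (box r k))%:R * k%:R / 4 := E2.
pose z (l : nat) : R := l%:R / (r k)%:R - 2^-1.
have Ey l I : mweight R r k.+1 (l :: I) - k.+1%:R / 2 = z l + y I.
  by rewrite /= /z /y -[k.+1]addn1 natrD; field; rewrite pnatr_eq0 -lt0n.
have Esq l I : (mweight R r k.+1 (l :: I) - k.+1%:R / 2) ^+ 2 =
    z l ^+ 2 + 2 * z l * y I + y I ^+ 2 by rewrite Ey; ring.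
rewrite !big_box; split.
  under eq_bigr => l _ do (under eq_bigr => I _ do rewrite Ey).
  under eq_bigr => l _ do rewrite big_split /= E1 addr0 big_const_seq count_predT iter_addr_0.
  by rewrite sumrMnl (sum_deviation rk) mul0rn.
under eq_bigr => l _ do (under eq_bigr => I _ do rewrite Esq).
have -> : \sum_(l < (r k).+1) \sum_(I <- box r k) (z l ^+ 2 + 2 * z l * y I + y I ^+ 2)
   = (\sum_(l < (r k).+1) z l ^+ 2) * (size (box r k))%:R +
     (r k).+1%:R * \sum_(I <- box r k) y I ^+ 2.
  rewrite (eq_bigr (fun l : 'I__ => z l ^+ 2 * (size (box r k))%:R +
       \sum_(I <- box r k) y I ^+ 2)) => [|l _].
    by rewrite big_split /= -mulr_suml sumr_const card_ord mulr_natl.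
  exact: sum_sqr_shift.
have hz : \sum_(l < (r k).+1) z l ^+ 2 <= (r k).+1%:R / 4.
  have -> : (r k).+1%:R / 4 = \sum_(l < (r k).+1) 4^-1 :> R.
    by rewrite sumr_const card_ord mulr_natl.
  by apply: ler_sum => l _; apply: deviation_sqr; rewrite // -ltnS.
have N0 : 0 <= (size (box r k))%:R :> R by [].
have h1 := ler_wpM2r N0 hz.
have h2 := ler_wpM2l (ler0n R (r k).+1) E2.
rewrite boxS size_allpairs size_iota natrM.
apply: le_trans (lerD h1 h2) _; rewrite -[k.+1]addn1 natrD; lra.
Qed.

Lemma box_tail k (eps : R) : 0 < eps -> (0 < k)%N -> (forall h, (h < k)%N -> (0 < r h)%N) ->
  (count (fun I => mweight R r k I < k%:R * (2^-1 - eps)) (box r k))%:R * (4 * eps ^+ 2 * k%:R)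
  <= (size (box r k))%:R.
Proof.
move=> e0 k0 hr; have [_ E2] := box_moments hr.
have hk : 0 < k%:R :> R by rewrite ltr0n.
set A := fun I => _.
have : (count A (box r k))%:R * (eps * k%:R) ^+ 2 <=
    \sum_(I <- box r k) (mweight R r k I - k%:R / 2) ^+ 2.
  rewrite -sum1_count natr_sum mulr_suml big_mkcond; apply: ler_sum => I _.
  case: ifP => hA; last exact: sqr_ge0.
  rewrite mul1r -[leRHS]sqrrN ler_sqr ?nnegrE; rewrite /A in hA.
  - by lra.
  - by rewrite mulr_ge0 // ltW.
  - by have := mulr_gt0 hk e0; lra.
move=> /le_trans/(_ E2); rewrite exprMn => h.
by rewrite -(ler_pM2r hk); lra.
Qed.

End Chebyshev.

(** * Siegel's lemma and powers of an algebraic number *)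

Section Siegel.

Lemma ltn_sqrS H : (0 < H)%N -> ((H * H).+1 < H.+1 ^ 2)%N.
Proof. by move=> H0; rewrite -mulnn mulSn mulnS; lia. Qed.

(** Pigeonhole on vectors with entries in [0, H], H = |Y| B: each linear form takes at most H^2 + 1
    values, and H^2 + 1 < (H + 1)^2. This is why twice as many unknowns as equations suffice. *)
Lemma siegel_lemma (X Y : finType) (A : X -> Y -> int) (B : nat) :
  (2 * #|X| <= #|Y|)%N -> (0 < #|Y|)%N -> (0 < B)%N -> (forall x y, `|A x y|%N <= B)%N ->
  exists c : Y -> int, [/\ exists y, c y != 0, forall x, \sum_y A x y * c y = 0 &
    forall y, (`|c y| <= #|Y| * B)%N].
Proof.
move=> hXY Y0 B0 hA; set H := (#|Y| * B)%N.
have H0 : (0 < H)%N by rewrite muln_gt0 Y0.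
(* The linear form shifted by a constant independent of v, so as to be a natural number: a negative
   coefficient multiplies H - v y instead of v y. *)
pose g (v : {ffun Y -> 'I_H.+1}) (x : X) : nat :=
  (\sum_y (if (0 <= A x y)%R then `|A x y| * v y else `|A x y| * (H - v y)))%N.
have gle v x : (g v x <= H * H)%N.
  rewrite {2}/H mulnC -mulnA -sum_nat_const leq_sum // => y _.
  by case: ifP => _; rewrite leq_mul // ?leq_subr // -ltnS.
pose G (v : {ffun Y -> 'I_H.+1}) : {ffun X -> 'I_(H * H).+1} := [ffun x => inord (g v x)].
have : ~~ injectiveb G.
  apply/negP => /injectiveP /leq_card; rewrite !card_ffun !card_ord leqNgt => /negP; apply.
  have h1 : ((H * H).+1 ^ #|X| <= (H.+1 ^ 2) ^ #|X|)%N.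
    by have [->|h] := posnP #|X|; rewrite // leq_exp2r // ltnW // ltn_sqrS.
  have [X0|X0] := posnP #|X|; first by rewrite X0 expn0 -(expn0 H.+1) ltn_exp2l.
  apply: (@leq_trans ((H.+1 ^ 2) ^ #|X|)); first by rewrite ltn_exp2r // ltn_sqrS.
  by rewrite -expnM leq_pexp2l.
case/injectivePn => v [w nvw eG].
exists (fun y => (v y)%:Z - (w y)%:Z); split.
- have [y hy] : exists y, v y != w y.
    apply/existsP; apply: contraNT nvw; rewrite negb_exists => /forallP h.
    by apply/eqP/ffunP => y; apply/eqP/negPn.
  by exists y; rewrite subr_eq0.
- move=> x; have eg : g v x = g w x.
    by have /ffunP/(_ x)/(congr1 val) := eG; rewrite !ffunE /= !inordK ?ltnS ?gle.
  have gE u : (g u x)%:Z = \sum_y A x y * (u y)%:Z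
      + \sum_y (if 0 <= A x y then 0 else `|A x y| * H%:Z).
    rewrite /g -big_split /= -[LHS]natz natr_sum; apply: eq_bigr => y _.
    have hu : (u y <= H)%N by rewrite -ltnS.
    case: ifP => hs; rewrite natz.
      by rewrite addr0 PoszM gez0_abs.
    have {}hs : A x y < 0 by rewrite ltNge hs.
    by rewrite PoszM -subzn // -[in RHS]abszE ltz0_abs //; ring.
  have := gE v; rewrite eg gE => /addIr e.
  rewrite (eq_bigr _ (fun y _ => mulrBr _ _ _)) sumrB; apply/eqP.
  by rewrite subr_eq0 e.
- by move=> y; have := ltn_ord (v y); have := ltn_ord (w y); lia.
Qed.

Lemma leq_abszB (u v : int) : (`|(u - v)%R| <= `|u| + `|v|)%N.
Proof. lia. Qed.

(** Multiplying by a x shifts the combination, and the only power that overflows, a x^d, is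
    rewritten by the equation of x. The factor a avoids denominators; a step multiplies the
    coefficients by at most |a| + |f_t| <= A. *)
Lemma algebraic_powers (R : realFieldType) (f : {poly int}) (x : R) :
  f != 0 -> root (map_poly intr f) x ->
  exists d (a : int) (A : nat), [/\ (0 < d)%N, a != 0, (`|a| <= A)%N &
    forall l, exists c : 'I_d -> int,
      a%:~R ^+ l * x ^+ l = \sum_t (c t)%:~R * x ^+ t /\ (forall t, `|c t| <= A ^ l)%N].
Proof.
move=> nz rt; pose d := (size f).-1; pose a := lead_coef f.
have sf : size f = d.+1 by rewrite /d prednK // lt0n size_poly_eq0.
pose A := (\sum_(i < d.+1) `|(f`_i)%R|)%N.
have E : a%:~R * x ^+ d = - \sum_(t < d) (f`_t)%:~R * x ^+ t.
  apply/eqP; rewrite -addr_eq0 addrC; move: rt; rewrite /root.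
  rewrite (@horner_coef_wide _ d.+1) ?(leq_trans (size_poly _ _)) ?sf //.
  rewrite big_ord_recr /= coef_map /= /a lead_coefE -/d.
  by under eq_bigr => i _ do rewrite coef_map.
have d0 : (0 < d)%N.
  rewrite lt0n; apply/eqP => d0; move: E; rewrite d0 big_ord0 oppr0 expr0 mulr1.
  by move/eqP; rewrite intr_eq0 lead_coef_eq0 (negPf nz).
have A_ge t : (t < d)%N -> (`|a| + `|(f`_t)%R| <= A)%N.
  move=> ht; rewrite /A big_ord_recr /= /a lead_coefE -/d addnC leq_add2r.
  by rewrite (bigD1 (Ordinal ht)) //= leq_addr.
exists d, a, A; split=> //; first by rewrite lead_coef_eq0.
  by apply: leq_trans (A_ge 0%N d0); rewrite leq_addr.
elim=> [|l [c [Ec hc]]].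
  exists (fun t => if t == 0%N :> nat then 1 else 0); split=> [|t]; last by case: ifP.
  rewrite (bigD1 (Ordinal d0)) //= big1 ?addr0 ?expr0 ?mulr1 // => t.
  by rewrite -val_eqE /= => /negPf ->; rewrite mul0r.
pose cn n : int := if insub n is Some t then c t else 0.
have cnE (t : 'I_d) : cn t = c t by rewrite /cn valK.
have hcn n : (`|cn n| <= A ^ l)%N by rewrite /cn; case: insub.
exists (fun t => (if t == 0%N :> nat then 0 else a * cn t.-1) - cn d.-1 * f`_t); split.
  rewrite !exprSr mulrACA Ec mulrA mulr_suml mulr_suml.
  pose F n : R := a%:~R * (cn n)%:~R * x ^+ n.+1.
  transitivity (\sum_(t < d) F t).
    by apply: eq_bigr => t _; rewrite /F cnE exprSr; ring.
  transitivity (\sum_(t < d) (if t == 0%N :> nat then 0 else F t.-1) + F d.-1).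
    rewrite -(prednK d0) big_ord_recr [in RHS]big_ord_recl /= add0r.
    by congr (_ + _); apply: eq_bigr => t _.
  have -> : F d.-1 = - \sum_(t < d) (cn d.-1)%:~R * (f`_t)%:~R * x ^+ t.
    rewrite /F prednK // mulrAC E mulNr mulr_suml; congr (- _).
    by apply: eq_bigr => t _; ring.
  rewrite -sumrB; apply: eq_bigr => t _; rewrite rmorphB mulrBl rmorphM; congr (_ - _).
  case: eqP => [_|/eqP ht]; first by rewrite mul0r.
  by rewrite /F prednK ?lt0n // rmorphM.
move=> t; apply: (@leq_trans (`|a| * A ^ l + A ^ l * `|(f`_t)%R|)%N).
  apply: leq_trans (leq_abszB _ _) _; rewrite abszM leq_add // ?leq_mul //.
  by case: ifP => _ //; rewrite abszM leq_mul.
by rewrite [(A ^ l * _)%N]mulnC -mulnDl expnS leq_mul2r A_ge ?orbT.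
Qed.
End Siegel.

(* [mval J b P] is the value at [b] of the Hasse derivative of [P] of
   multi-order [J]. *)
Fixpoint mval (R : idomainType) k (J : seq nat) (b : nat -> R) : mpol R k -> R :=
  match k return mpol R k -> R with
  | 0 => id
  | k'.+1 => fun P => mval (behead J) b
       ((P : {poly mpol R k'})^`N(head 0%N J)).[mpolC R k' (b k')]
  end.

Fixpoint mpoly_of (R : idomainType) (r : nat -> nat) k (c : seq nat -> int) : mpol R k :=
  match k return mpol R k with
  | 0 => (c [::])%:~R
  | k'.+1 => \poly_(l < (r k').+1) mpoly_of R r k' (fun J => c (l :: J))
  end.

Section Evaluation.
Variable R : realFieldType.
Implicit Types (r : nat -> nat) (b : nat -> R).

Lemma mval0 k J b : mval J b (0 : mpol R k) = 0.
Proof. by elim: k J => [//|k IH] J /=; rewrite raddf0 horner0. Qed.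

Lemma mvalD k J b (P Q : mpol R k) : mval J b (P + Q) = mval J b P + mval J b Q.
Proof. by elim: k J P Q => [//|k IH] J P Q /=; rewrite raddfD hornerD IH. Qed.

Lemma mvalCM k J b c (P : mpol R k) : mval J b (mpolC R k c * P) = c * mval J b P.
Proof.
elim: k J P => [//|k IH] J P.
by rewrite [mpolC R k.+1 c * P]mul_polyC /= nderivnZ hornerZ IH.
Qed.

Lemma mval_sum k J b (I : Type) (s : seq I) (F : I -> mpol R k) :
  mval J b (\sum_(i <- s) F i) = \sum_(i <- s) mval J b (F i).
Proof. exact: (big_morph _ (mvalD J b) (mval0 k J b)). Qed.

Lemma mdeg_horner_nderivn r k (P : mpol R k.+1) l c : mdeg r P ->
  mdeg r ((P : {poly mpol R k})^`N(l).[mpolC R k c]).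
Proof.
move=> [_ cP]; rewrite horner_coef; apply: mdeg_sum => i _.
rewrite coef_nderivn -mulr_natr -(rmorph_nat (mpolC R k)) -rmorphXn /= mulrC.
by apply: mdegCM; rewrite mulrC; apply: mdegCM; apply: cP.
Qed.

Lemma vanishes_mval r b k th (P : mpol R k) : mdeg r P ->
  (forall J, J \in box r k -> mweight R r k J < th -> mval J b P = 0) -> vanishes r b th P.
Proof.
elim: k th P => [|k IH] th P dP h.
  by move=> th0; apply: (h [::]) => //; rewrite inE.
move=> l; have [hl|hl] := leqP l (r k); last first.
  rewrite nderivn_poly0 ?horner0; first exact: vanishes0.
  by case: dP => + _; move/leq_trans; apply.
apply: IH; first exact: mdeg_horner_nderivn.
move=> J hJ hw; apply: (h (l :: J)); first by rewrite mem_boxS hl.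
by rewrite /= -ltrBrDl.
Qed.

Lemma mdeg_mpoly_of r k c : mdeg r (mpoly_of R r k c).
Proof.
elim: k c => [//|k IH] c; split=> [|i]; first exact: size_poly.
by rewrite coef_poly; case: ifP => _; [exact: IH|exact: mdeg0].
Qed.

Lemma mcoef_mpoly_of r k c J : J \in box r k -> mcoef J (mpoly_of R r k c) = (c J)%:~R.
Proof.
elim: k c J => [|k IH] c J; first by rewrite inE => /eqP ->.
case: J => [|l J]; first by move/boxP => [].
by rewrite mem_boxS => /andP[hl hJ] /=; rewrite coef_poly ltnS hl IH.
Qed.

Lemma mnorm_mpoly_of r k c :
  mnorm (mpoly_of R r k c) <= \sum_(J <- box r k) `|(c J)%:~R|.
Proof.
elim: k c => [|k IH] c; first by rewrite big_seq1.
rewrite big_box (mnormE (size_poly _ _)); apply: ler_sum => l _.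
by rewrite coef_poly ltn_ord; apply: IH.
Qed.

Fixpoint mbin k (I J : seq nat) : nat :=
  if k is k'.+1 then 'C(head 0 I, head 0 J) * mbin k' (behead I) (behead J) else 1.

Fixpoint msub k (I J : seq nat) : nat :=
  if k is k'.+1 then (head 0 I - head 0 J) + msub k' (behead I) (behead J) else 0.

Lemma mval_mpoly_of r k c J x : mval J (fun _ => x) (mpoly_of R r k c) =
  \sum_(I <- box r k) (c I)%:~R * (mbin k I J)%:R * x ^+ msub k I J.
Proof.
elim: k c J => [|k IH] c J; first by rewrite big_seq1 /= !mulr1.
rewrite big_box [LHS]/= poly_def raddf_sum horner_sum mval_sum.
apply: eq_bigr => l _; set j := head 0%N J.
have -> : (mpoly_of R r k (fun I => c (nat_of_ord l :: I)) *: 'X^l)^`N(j).[mpolC R k x] =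
    mpolC R k ('C(l, j)%:R * x ^+ (l - j)) * mpoly_of R r k (fun I => c (nat_of_ord l :: I)).
  rewrite nderivnZ nderivnXn hornerZ hornerMn hornerXn rmorphM rmorph_nat rmorphXn /=.
  by rewrite mulrC mulr_natl.
rewrite mvalCM IH mulr_sumr; apply: eq_bigr => I _.
by rewrite /= natrM exprD -/j; ring.
Qed.

Lemma mbin_le k I J : (mbin k I J <= 2 ^ sumn I)%N.
Proof.
elim: k I J => [|k IH] I J /=; first by rewrite expn_gt0.
case: I => [|i I] /=.
  by rewrite bin0n mulnC; case: (head _ _ == _); rewrite ?muln0 // muln1 IH.
rewrite expnD; apply: leq_mul; last exact: IH.
have -> : (2 ^ i = (1 + 1) ^ i)%N by []; rewrite expnDn.
have [hl|hl] := leqP (head 0 J) i; last by rewrite bin_small.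
by rewrite (bigD1 (inord (head 0 J))) //= inordK ?ltnS // !exp1n !muln1 leq_addr.
Qed.

Lemma msub_le k I J : (msub k I J <= sumn I)%N.
Proof.
elim: k I J => [|k IH] I J //=; case: I => [|i I] /=; first by rewrite sub0n add0n IH.
by rewrite leq_add ?leq_subr.
Qed.
End Evaluation.

Section AuxiliaryPolynomial.
Variable R : archiRealFieldType.

Lemma mint_mpoly_of r k c : mint (mpoly_of R r k c).
Proof.
elim: k c => [|k IH] c; first exact: intr_int.
by move=> i; rewrite coef_poly; case: ifP => _; [exact: IH|exact: mint0].
Qed.

(** The vanishing of one derivative at x is a linear equation in the unknown coefficients.
    Multiplied by a^S and reduced by [algebraic_powers], it follows from d integral equations; the
    counting hypothesis provides twice as many unknowns. *)
Theorem auxiliary_polynomial (f : {poly int}) (x : R) :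
  f != 0 -> root (map_poly intr f) x ->
  exists d B : nat, [/\ (0 < d)%N, (0 < B)%N & forall r k th,
    (2 * (count (fun J => mweight R r k J < th)%R (box r k) * d) <= size (box r k))%N ->
    exists P : mpol R k, [/\ P != 0, mint P, mdeg r P, vanishes r (fun _ => x) th P &
      mnorm P <= (B ^ (\sum_(h < k) r h))%:R]].
Proof.
move=> nz rt; have [d [a [A [d0 a0 leaA hA]]]] := algebraic_powers nz rt.
have A0 : (0 < A)%N by apply: leq_trans leaA; rewrite absz_gt0.
(* There are at most 2^S coefficients, each bounded in Siegel's lemma by their number times the
   entry bound 2^S A^S: in all (8 A)^S. *)
exists d, (8 * A)%N; split=> //; first by rewrite muln_gt0.
move=> r k th hcount; set S := (\sum_(h < k) r h)%N.
pose bx := box r k; pose js := [seq J <- bx | mweight R r k J < th].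
have [c hc] := choice hA.
pose Im (y : 'I_(size bx)) := nth [::] bx y.
pose Jm (x : 'I_(size js) * 'I_d) := nth [::] js x.1.
have Im_box y : Im y \in bx by apply: mem_nth.
pose M (x : 'I_(size js) * 'I_d) (y : 'I_(size bx)) : int :=
  (mbin k (Im y) (Jm x))%:Z * a ^+ (S - msub k (Im y) (Jm x)) * c (msub k (Im y) (Jm x)) x.2.
have sub_S y J : (msub k (Im y) J <= S)%N.
  by have [_ h] := boxP (Im_box y); apply: leq_trans (msub_le _ _ _) h.
have bx0 : (0 < size bx)%N by case/andP: (size_box r k).
have hM z y : (`|M z y| <= 2 ^ S * A ^ S)%N.
  have [_ h] := boxP (Im_box y).
  rewrite /M !abszM absz_nat abszX -mulnA leq_mul //.
    by rewrite (leq_trans (mbin_le _ _ _)) // leq_pexp2l.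
  rewrite -{2}(subnK (sub_S y (Jm z))) expnD leq_mul //; last first.
    by have [_] := hc (msub k (Im y) (Jm z)).
  by case: (S - _)%N => [//|n]; rewrite leq_exp2r.
have [|||v [[y0 hy0] hv hvB]] := @siegel_lemma _ _ M (2 ^ S * A ^ S)%N _ _ _ hM.
- by rewrite card_prod !card_ord size_filter.
- by rewrite card_ord.
- by rewrite muln_gt0 !expn_gt0 A0.
pose cf (J : seq nat) : int := if insub (index J bx) is Some y then v y else 0.
have cfE y : cf (Im y) = v y by rewrite /cf /Im index_uniq ?box_uniq // valK.
have big_bx (V : nmodType) (F : seq nat -> V) : \sum_(I <- bx) F I = \sum_y F (Im y).
  by rewrite (big_nth [::]) big_mkord.
exists (mpoly_of R r k cf); split.
- apply: contraNneq hy0 => P0.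
  have := mcoef_mpoly_of R cf (Im_box y0); rewrite P0 mcoef0 cfE => /esym/eqP.
  by rewrite intr_eq0.
- exact: mint_mpoly_of.
- exact: mdeg_mpoly_of.
- apply: vanishes_mval; first exact: mdeg_mpoly_of.
  move=> J hJ hw; have hJ' : J \in js by rewrite mem_filter hw.
  have ij : (index J js < size js)%N by rewrite index_mem.
  have aS : a%:~R ^+ S != 0 :> R by rewrite expf_neq0 // intr_eq0.
  apply: (mulfI aS); rewrite mulr0 mval_mpoly_of big_bx mulr_sumr.
  transitivity (\sum_(t < d) x ^+ t * (\sum_y M (Ordinal ij, t) y * v y)%:~R); last first.
    by apply: big1 => t _; rewrite hv mulr0.
  under [RHS]eq_bigr => t _ do rewrite rmorph_sum mulr_sumr.
  rewrite exchange_big /=; apply: eq_bigr => y _.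
  have EJ : Jm (Ordinal ij, Ordinal d0) = J by rewrite /Jm /= nth_index.
  set e := msub k (Im y) J; have [Ee _] := hc e.
  rewrite cfE -(subnK (sub_S y J)) -/e exprD.
  transitivity ((v y)%:~R * (mbin k (Im y) J)%:R * a%:~R ^+ (S - e) *
    (a%:~R ^+ e * x ^+ e)); first by ring.
  rewrite Ee mulr_sumr; apply: eq_bigr => t _.
  have EJt : Jm (Ordinal ij, t) = J by rewrite /Jm /= nth_index.
  by rewrite /M EJt -/e !rmorphM rmorphXn /=; ring.
apply: le_trans (mnorm_mpoly_of _ _ _ _) _; rewrite big_bx.
apply: (@le_trans _ _ (\sum_(y < size bx) (size bx * (2 ^ S * A ^ S))%:R)).
  apply: ler_sum => y _; rewrite cfE -intr_norm -abszE ler_nat.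
  by rewrite -{1}[size bx]card_ord.
rewrite sumr_const card_ord -[leLHS]mulr_natl -natrM ler_nat.
have /andP[_ hbx] := size_box r k; rewrite -/bx -/S in hbx.
apply: (@leq_trans (2 ^ S * (2 ^ S * (2 ^ S * A ^ S)))%N); first by rewrite !leq_mul.
by rewrite -!expnMn !mulnA.
Qed.
End AuxiliaryPolynomial.

(** * Roth's theorem *)

Section Taylor.
Variable R : realType.
Implicit Types (r : nat -> nat) (b : nat -> R).

Lemma eq_ler (u v : R) : u = v -> u <= v.
Proof. by move=> ->. Qed.

Lemma horner_nderivn (A : comNzRingType) (p : {poly A}) c j m : (size p <= m)%N ->
  p^`N(j).[c] = \sum_(i < m) c ^+ (i - j) *+ 'C(i, j) * p`_i.
Proof.
move=> hm; have E : p = \sum_(i < m) p`_i *: 'X^i.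
  rewrite -poly_def; apply/polyP => i; rewrite coef_poly; case: ltnP => // hi.
  by rewrite nth_default // (leq_trans hm).
rewrite {1}E raddf_sum horner_sum; apply: eq_bigr => i _.
by rewrite /= nderivnZ nderivnXn hornerZ hornerMn hornerXn mulrC.
Qed.

Lemma mnorm_horner_nderivn r k (P : mpol R k.+1) x j : mdeg r P ->
  mnorm ((P : {poly mpol R k})^`N(j).[mpolC R k x]) <=
  \sum_(i < (r k).+1) `|x| ^+ (i - j) *+ 'C(i, j) * mnorm (P : {poly mpol R k})`_i.
Proof.
case=> sP _; rewrite (horner_nderivn _ _ sP); apply: le_trans (mnorm_sum _ _ _) _.
apply: ler_sum => i _; rewrite -rmorphXn -rmorphMn; apply: le_trans (mnormCM _ _) _.
by rewrite normrMn normrX.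
Qed.

Lemma sum_mnorm_taylor r k (P : mpol R k.+1) x : mdeg r P ->
  \sum_(n < (r k).+1) mnorm ((P : {poly mpol R k})^`N(n).[mpolC R k x]) <=
  (1 + `|x|) ^+ r k * mnorm P.
Proof.
move=> dP; apply: (@le_trans _ _ (\sum_(n < (r k).+1) \sum_(i < (r k).+1)
    `|x| ^+ (i - n) *+ 'C(i, n) * mnorm (P : {poly mpol R k})`_i)).
  by apply: ler_sum => n _; apply: mnorm_horner_nderivn.
rewrite exchange_big /= -/(mnorm P) (mnormE (n := (r k).+1)); last by case: dP.
rewrite mulr_sumr; apply: ler_sum => i _; rewrite -mulr_suml ler_wpM2r ?mnorm_ge0 //.
have hi : (i <= r k)%N by rewrite -ltnS.
have -> : \sum_(n < (r k).+1) `|x| ^+ (i - n) *+ 'C(i, n) = (1 + `|x|) ^+ i.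
  rewrite [1 + _]addrC exprDn.
  rewrite (big_ord_widen _ (fun n => `|x| ^+ (i - n) * 1 ^+ n *+ 'C(i, n)) (ltn_ord i)).
  rewrite [RHS]big_mkcond; apply: eq_bigr => n _; rewrite expr1n mulr1 ltnS.
  by case: leqP => // h; rewrite bin_small.
by rewrite ler_weXn2l // lerDl.
Qed.

(** A displacement of size exp(-M / r_h) makes a Taylor term of weight w cost exp(-M w). Since [P]
    has index th at x, only terms of weight at least th minus the weight of J survive. The base 2 (1
    + |x|) covers binomials and powers of x. *)
Lemma mval_taylor r b x M k J th (P : mpol R k) : 0 <= M ->
  (forall h, (h < k)%N -> (0 < r h)%N /\ `|b h - x| <= expR (- (M / (r h)%:R))) ->
  mdeg r P -> vanishes r (fun _ => x) th P ->
  `|mval J b P| <=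
    (2 * (1 + `|x|)) ^+ (\sum_(h < k) r h) * mnorm P * expR (- (M * (th - mweight R r k J))).
Proof.
move=> M0; elim: k J th P => [|k IH] J th P hb dP van.
  rewrite big_ord0 mul1r /= subr0; have [th0|th0] := ltP 0 th.
    by rewrite (van th0) normr0 mul0r.
  by rewrite ler_peMr // -expR0 ler_expR oppr_ge0 mulr_ge0_le0.
have [rk hk] := hb k (leqnn _); have hr : (r k)%:R != 0 :> R by rewrite pnatr_eq0 -lt0n.
set l := head 0%N J; pose Q n := (P : {poly mpol R k})^`N(n).[mpolC R k x].
set Bk := (2 * (1 + `|x|)) ^+ (\sum_(h < k) r h).
have Bk0 : 0 <= Bk by rewrite exprn_ge0 // mulr_ge0 // addr_ge0.
set E := expR _; rewrite [mval _ _ _]/= -/l.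
have RHS0 : 0 <= (2 * (1 + `|x|)) ^+ (\sum_(h < k.+1) r h) * mnorm P * E.
  by rewrite !mulr_ge0 ?expR_ge0 ?mnorm_ge0 // exprn_ge0 // mulr_ge0 // addr_ge0.
have [hl|hl] := leqP l (r k); last first.
  rewrite nderivn_poly0 ?horner0 ?mval0 ?normr0 //.
  by case: dP => + _; move/leq_trans; apply.
have Eb : mpolC R k (b k) = mpolC R k x + mpolC R k (b k - x) by rewrite rmorphB addrC subrK.
have szl : (size ((P : {poly mpol R k})^`N(l)) <= (r k).+1 - l)%N.
  case: dP => sP _; apply/leq_sizeP => j hj; rewrite coef_nderivn nth_default ?mul0rn //.
  by apply: leq_trans sP _; rewrite -leq_subLR.
rewrite Eb (nderiv_taylor_wide (mulrC _ _) szl) mval_sum.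
apply: le_trans (ler_norm_sum _ _ _) _.
apply: (@le_trans _ _ (\sum_(i < (r k).+1 - l) 2 ^+ r k * Bk * E * mnorm (Q (l + i)%N))).
  apply: ler_sum => i _; have hi : (l + i <= r k)%N by rewrite -ltnS -ltn_subRL.
  rewrite nderivn_nderivn hornerMn -mulr_natr -(rmorph_nat (mpolC R k)) -rmorphXn.
  rewrite -mulrA -rmorphM /= mulrC mvalCM normrM normrM normr_nat normrX.
  have H1 : 'C(l + i, i)%:R <= 2 ^+ r k :> R.
    rewrite -natrX ler_nat; apply: (@leq_trans (2 ^ (l + i))%N); last by rewrite leq_pexp2l.
    have := mbin_le 1 [:: (l + i)%N] [:: nat_of_ord i].
    by rewrite /= muln1 addn0.
  have H2 : `|b k - x| ^+ i <= expR (- (M * (i%:R / (r k)%:R))).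
    apply: le_trans (lerXn2r i _ _ hk) _; rewrite ?nnegrE ?expR_ge0 //.
    by rewrite -expRM_natr ler_expR; apply: eq_ler; ring.
  have H3 := IH (behead J) (th - (l + i)%:R / (r k)%:R) (Q (l + i)%N)
    (fun h hh => hb h (ltnW hh)) (mdeg_horner_nderivn _ _ dP) (van (l + i)%N).
  apply: le_trans (ler_pM _ _ (ler_pM _ _ H1 H2) H3) _; rewrite ?mulr_ge0 ?exprn_ge0 //.
  rewrite -/Bk; set E1 := expR _; set E2 := expR _.
  have -> : E = E1 * E2.
    rewrite -expRD; congr expR; rewrite /= -/l natrD; field.
    exact: hr.
  by apply: eq_ler; ring.
have -> : (2 * (1 + `|x|)) ^+ (\sum_(h < k.+1) r h) = Bk * (2 ^+ r k * (1 + `|x|) ^+ r k).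
  by rewrite big_ord_recr exprD -exprMn.
rewrite -mulr_sumr.
apply: (@le_trans _ _ (2 ^+ r k * Bk * E * ((1 + `|x|) ^+ r k * mnorm P))); last first.
  by apply: eq_ler; ring.
rewrite ler_wpM2l //.
  by apply: mulr_ge0; [apply: mulr_ge0; [exact: exprn_ge0|exact: Bk0]|exact: expR_ge0].
apply: (le_trans _ (sum_mnorm_taylor x dP)).
have e : ((r k).+1 = l + ((r k).+1 - l))%N by rewrite subnKC // leqW.
have -> : \sum_(n < (r k).+1) mnorm (Q n) = \sum_(n < l + ((r k).+1 - l)) mnorm (Q n).
  by rewrite -e.
rewrite big_split_ord /= lerDr; apply: sumr_ge0 => i _; exact: mnorm_ge0.
Qed.

End Taylor.

Section Roth.
Variable R : realType.

Lemma mval_denominator (r : nat -> nat) (p : nat -> int) (q : nat -> nat) k J (P : mpol R k) :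
  (forall h, (h < k)%N -> (0 < q h)%N) -> mint P -> mdeg r P ->
  (\prod_(h < k) (q h)%:R ^+ r h) * mval J (fun h => (p h)%:~R / (q h)%:R) P \is a Num.int.
Proof.
elim: k J P => [|k IH] J P hq hP dP; first by rewrite big_ord0 mul1r.
have q0 : (q k)%:R != 0 :> R by rewrite pnatr_eq0 -lt0n hq.
rewrite big_ord_recr [mval _ _ _]/= -mulrA -mvalCM.
apply: IH => [h hh||]; first by rewrite hq // ltnW.
  have [sP _] := dP; rewrite (horner_nderivn _ _ sP) mulr_sumr.
  apply: mint_sum => i _; rewrite mulrA; apply: mintM; last exact: hP.
  rewrite -(rmorphXn (mpolC R k)) -(rmorphMn (mpolC R k)) -(rmorphM (mpolC R k)).
  apply: mintC => /=.
  rewrite mulrnAr -mulr_natr; apply: rpredM; last exact: natr_int.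
  have hi : (i - head 0%N J <= r k)%N by rewrite leq_subLR (leq_trans _ (leq_addl _ _)) // -ltnS.
  have -> : (q k)%:R ^+ r k =
      (q k)%:R ^+ (r k - (i - head 0%N J)) * (q k)%:R ^+ (i - head 0%N J) :> R.
    by rewrite -exprD subnK.
  rewrite expr_div_n -mulrA [(q k)%:R ^+ (i - _) * _]mulrC divfK ?expf_neq0 //.
  by apply: rpredM; apply: rpredX; [exact: natr_int|exact: intr_int].
by apply: mdegCM; apply: mdeg_horner_nderivn.
Qed.

Lemma int_small_eq0 (x : R) : x \is a Num.int -> `|x| < 1 -> x = 0.
Proof.
move=> hx lt1; apply/eqP; apply: contraTT lt1 => nz.
by rewrite -leNgt; apply: norm_intr_ge1.
Qed.

Lemma prod_expR_le (r q : nat -> nat) k (c : R) :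
  (forall h, (h < k)%N -> (0 < q h)%N /\ (r h)%:R * ln (q h)%:R <= c) ->
  \prod_(h < k) (q h)%:R ^+ r h <= expR (k%:R * c).
Proof.
elim: k => [|k IH] h; first by rewrite big_ord0 mul0r expR0.
have [q0 hc] := h k (leqnn _).
rewrite big_ord_recr /= -[k.+1]addn1 natrD mulrDl mul1r expRD.
have q0' : 0 < (q k)%:R :> R by rewrite ltr0n.
apply: ler_pM; first by apply: prodr_ge0 => i _; rewrite exprn_ge0.
- by rewrite exprn_ge0.
- by apply: IH => i hi; apply: h; apply: ltnW.
by rewrite -{1}[(q k)%:R]lnK ?posrE // -expRM_natr ler_expR mulrC.
Qed.

Lemma ger1_mul2D1 (t : R) : 0 <= t -> 1 <= 2 * (1 + t).
Proof. by lra. Qed.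

(** With eps = delta / 20 the gain delta k / 2 is 10 eps k, whereas the error terms add up to at
    most 8 eps k. *)
Lemma roth_exponent (k delta L : R) : 1 <= k -> 0 < delta <= 1 -> 0 < L ->
  k * ((1 + delta / 20) * L) + (k * (delta / 20) * L +
    - ((2 + delta) * L * (k * (2^-1 - delta / 20) - delta / 20))) < 0.
Proof.
move=> k1 /andP[d0 d1] L0; set eps := delta / 20.
have eps0 : 0 < eps by rewrite divr_gt0.
have e0 : delta = 20 * eps by rewrite /eps; field.
have eps1 : eps <= 20^-1 by rewrite /eps; lra.
have e1 : eps * 1 <= eps * k by rewrite ler_pM2l.
have e2 : eps * eps <= eps * (eps * k) by rewrite ler_pM2l //; lra.
have e3 : eps * (eps * k) <= 20^-1 * (eps * k).
  by rewrite ler_wpM2r // mulr_ge0 ?ltW // (lt_le_trans ltr01).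
have ek : 0 < eps * k by rewrite mulr_gt0 // (lt_le_trans ltr01).
rewrite [ltLHS](_ : _ = L * (k * (1 + 2 * eps) - (2 + delta) * (k * (2^-1 - eps) - eps))).
  by rewrite pmulr_rlt0 // e0; lra.
by ring.
Qed.

(** If the denominators were unbounded, arbitrarily large ones could be selected one after the
    other, as fast increasing as Roth's lemma demands. *)
Theorem roth (f : {poly int}) (x delta : R) : f != 0 -> root (map_poly intr f) x ->
  0 < delta -> exists B : nat, forall (p : int) (q : nat), (0 < q)%N -> coprimez p q ->
  `|x - p%:~R / q%:R| <= expR (- ((2 + delta) * ln q%:R)) -> (q <= B)%N.
Proof.
move=> fnz rt; wlog delta1 : delta / delta <= 1.
  move=> H d0; have [|h1] := leP delta 1; first by move=> h; apply: H.
  have [||B hB] := H 1 _ _ => //; exists B => p q q0 cpq hx; apply: hB cpq _ => //.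
  apply: le_trans hx _; rewrite ler_expR lerN2 ler_wpM2r ?ln_ge0 ?ler1n //.
  by rewrite lerD2l ltW.
move=> d0; apply: contrapT => /forallNP H.
have good (Y : R) : exists pq : int * nat, [/\ (0 < pq.2)%N, coprimez pq.1 pq.2,
    `|x - pq.1%:~R / pq.2%:R| <= expR (- ((2 + delta) * ln pq.2%:R)) & Y <= ln pq.2%:R].
  have /existsNP [p /existsNP [q /not_implyP [q0 /not_implyP [cpq /not_implyP [hx /negP hq]]]]] :=
    H (Num.truncn (expR Y)).
  exists (p, q); split=> //=; rewrite -ltnNge in hq.
  rewrite -[Y]expRK ler_ln ?posrE ?expR_gt0 ?ltr0n //.
  have /andP[_ h] := truncn_itv (expR_ge0 Y).
  by rewrite (le_trans (ltW h)) // ler_nat.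
have [pick hpick] := choice good.
have [d [A [dpos Apos haux]]] := auxiliary_polynomial fnz rt.
pose eps : R := delta / 20; have eps0 : 0 < eps by rewrite divr_gt0.
(* Enough variables for Chebyshev's bound 1 / (4 eps^2 k) on the proportion of small monomials to be
   at most 1 / (2 d). *)
pose K := Num.truncn (d%:R / (2 * eps ^+ 2)).
have hK : 2 * d%:R <= 4 * eps ^+ 2 * K.+1%:R.
  have e2 : 0 < 2 * eps ^+ 2 by rewrite mulr_gt0 // exprn_gt0.
  have /andP[_ h] := truncn_itv (divr_ge0 (ler0n R d) (ltW e2)).
  by move: h; rewrite -/K ltr_pdivrMr //; lra.
have [om /andP[om0 om1] hroth] := roth_lemma K eps0.
pose k := K.+1; have k0 : 0 < k%:R :> R by rewrite ltr0n.
(* Thresholds for ln q_0: c1 yields the norm hypothesis of Roth's lemma, c2 makes the constants of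
   the Taylor estimate at most exp(k eps L). *)
pose c1 := k%:R * ln A%:R / om.
pose c2 := (ln (2 * (1 + `|x|)) + ln A%:R) / eps.
have lnA0 : 0 <= ln A%:R :> R by rewrite ln_ge0 // ler1n.
(* The r_h ln q_h will agree up to a factor 2, so the ratio 2 / om between successive ln q_h forces
   r_(h+1) <= om r_h. *)
pose u := fix u h := if h is h'.+1 then pick (2 / om * ln (u h').2%:R)
   else pick (Num.max (om^-1) (Num.max c1 c2)).
pose p h := (u h).1; pose q h := (u h).2.
have hu h : [/\ (0 < q h)%N, coprimez (p h) (q h) &
    `|x - (p h)%:~R / (q h)%:R| <= expR (- ((2 + delta) * ln (q h)%:R))].
  have [Y uE] : exists Y, u h = pick Y by case: h => [|h]; eexists.
  by rewrite /p /q uE; have [] := hpick Y.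
have hq0 : [/\ om^-1 <= ln (q 0%N)%:R, c1 <= ln (q 0%N)%:R & c2 <= ln (q 0%N)%:R].
  have [_ _ _] := hpick (Num.max (om^-1) (Num.max c1 c2)).
  by rewrite !ge_max => /and3P[].
have hqS h : 2 / om * ln (q h)%:R <= ln (q h.+1)%:R by case: (hpick (2 / om * ln (q h)%:R)).
have [q0om q0c1 q0c2] := hq0.
have omq : 1 <= om * ln (q 0%N)%:R by rewrite mulrC -ler_pdivrMr // div1r.
have q0_1 : 1 <= ln (q 0%N)%:R :> R by apply: le_trans q0om; rewrite invf_ge1.
have qS_ge h : 0 <= ln (q h)%:R :> R -> ln (q h)%:R <= ln (q h.+1)%:R :> R.
  move=> h0; apply: le_trans (hqS h); rewrite ler_peMl // ler_pdivlMr // mul1r.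
  by rewrite (le_trans om1) // ler1n.
have lnq_ge1 h : 1 <= ln (q h)%:R :> R.
  elim: h => [//|h IH]; exact: le_trans IH (qS_ge h (le_trans ler01 IH)).
have lnq0 h : 0 < ln (q h)%:R :> R by apply: lt_le_trans ltr01 _.
(* Large enough that each ln q_h is at most eps L: rounding L / ln q_h up to an integer then changes
   r_h ln q_h by at most eps L. *)
pose r0 := (Num.truncn (\sum_(h < k) ln (q h)%:R / eps)).+1.
pose L : R := r0%:R * ln (q 0%N)%:R.
have L0 : 0 < L by rewrite mulr_gt0 // ltr0n.
have hL h : (h < k)%N -> ln (q h)%:R <= eps * L.
  move=> hk; have sge : ln (q h)%:R / eps <= \sum_(h < k) ln (q h)%:R / eps.
    rewrite (bigD1 (Ordinal hk)) //= lerDl sumr_ge0 // => i _.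
    by rewrite divr_ge0 // ltW.
  have s0 : 0 <= \sum_(h < k) ln (q h)%:R / eps.
    by apply: sumr_ge0 => i _; rewrite divr_ge0 // ltW.
  have /andP[_ hr0] := truncn_itv s0.
  rewrite mulrC -ler_pdivrMr // (le_trans sge) // (le_trans (ltW hr0)) //.
  by rewrite /L ler_peMr.
pose r h := if h is h'.+1 then (Num.truncn (L / ln (q h)%:R)).+1 else r0.
have r_gt0 h : (0 < r h)%N by case: h.
have rL h : (h < k)%N -> L <= (r h)%:R * ln (q h)%:R <= (1 + eps) * L.
  move=> hk; case: h hk => [|h] hk.
    by rewrite -/L lexx ler_peMl ?(ltW L0) // lerDl ltW.
  have /andP[h1 h2] := truncn_itv (divr_ge0 (ltW L0) (ltW (lnq0 h.+1))).
  rewrite /r; apply/andP; split.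
    by rewrite -ler_pdivrMr // ltW.
  rewrite -[(_).+1]addn1 natrD mulrDl !mul1r mulrDl mul1r lerD ?hL //.
  by rewrite -ler_pdivlMr.
have hr h : (h < K)%N -> (r h.+1)%:R <= om * (r h)%:R.
  move=> hk; have /andP[_ h1] := rL h.+1 hk; have /andP[h2 _] := rL h (ltnW hk).
  have eps1 : eps <= 1 by rewrite ler_pdivrMr // (le_trans delta1) // mul1r ler1n.
  have h3 : (r h.+1)%:R * (2 / om * ln (q h)%:R) <= (r h.+1)%:R * ln (q h.+1)%:R.
    by rewrite ler_wpM2l.
  have h4 : (1 + eps) * L <= 2 * ((r h)%:R * ln (q h)%:R).
    by apply: ler_pM => //; [rewrite addr_ge0 // ltW|exact: ltW|rewrite lerD2l].
  have := le_trans h3 (le_trans h1 h4).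
  rewrite [leLHS](_ : _ = 2 * ln (q h)%:R * ((r h.+1)%:R / om)); last by ring.
  rewrite [leRHS](_ : _ = 2 * ln (q h)%:R * (r h)%:R); last by ring.
  by rewrite ler_pM2l ?mulr_gt0 // ler_pdivrMr // mulrC.
have r_le h : (h < k)%N -> (r h <= r 0%N)%N.
  elim: h => [//|h IH] hk; apply: leq_trans (IH (ltnW hk)).
  by rewrite -(ler_nat R) (le_trans (hr h hk)) // ler_piMl.
set S := (\sum_(h < k) r h)%N.
have hS : S%:R <= k%:R * r0%:R :> R.
  rewrite -natrM ler_nat -[X in (_ <= X * _)%N]card_ord -sum_nat_const leq_sum // => h _.
  exact: r_le.
have r_pos h : (h < k)%N -> (0 < r h)%N by [].
have cnt : (2 * (count (fun J => mweight R r k J < k%:R * (2^-1 - eps))%R (box r k) * d)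
    <= size (box r k))%N.
  rewrite -(ler_nat R) natrM natrM; apply: le_trans (box_tail eps0 (ltn0Sn K) r_pos).
  by rewrite mulrCA ler_wpM2l.
have [P [Pnz Pint Pdeg Pvan Pnorm]] := haux r k _ cnt.
have lnP : ln (mnorm P) <= S%:R * ln A%:R.
  have P1 := mnorm_ge1 Pint Pnz.
  have -> : S%:R * ln A%:R = ln (A ^ S)%:R :> R.
    by rewrite natrX lnXn ?ltr0n // mulr_natl.
  by rewrite ler_ln // posrE ?ltr0n ?expn_gt0 ?Apos // (lt_le_trans ltr01).
pose b h : R := (p h)%:~R / (q h)%:R.
apply: (hroth r p q _ hr omq P Pnz Pint Pdeg).
- move=> h hk; have [qh0 cpq _] := hu h; have /andP[h1 _] := rL h hk; split=> //.
  rewrite ltn_neqAle qh0 andbT; apply: contraTneq (lnq_ge1 h) => <-.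
  by rewrite ln1 -ltNge.
- apply: le_trans lnP _; apply: le_trans (ler_wpM2r lnA0 hS) _.
  have : k%:R * ln A%:R <= om * ln (q 0%N)%:R by rewrite [leRHS]mulrC -ler_pdivrMr.
  move=> h; rewrite [leLHS](_ : _ = r0%:R * (k%:R * ln A%:R)); last by ring.
  by rewrite [leRHS]mulrCA ler_wpM2l.
(* It remains to annihilate the derivatives of weight below eps: multiplied by the common
   denominator [D] they are integers, and their size is below 1. *)
apply: vanishes_mval => // J hJ hw.
pose M := (2 + delta) * L; pose th := k%:R * (2^-1 - eps).
have M0 : 0 <= M by rewrite mulr_ge0 ?ltW // addr_gt0.
have hb h : (h < k)%N -> (0 < r h)%N /\ `|b h - x| <= expR (- (M / (r h)%:R)).
  move=> hk; split=> //; have [_ _] := hu h; rewrite distrC => /le_trans; apply.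
  have /andP[h1 _] := rL h hk.
  rewrite ler_expR lerN2 ler_pdivrMr ?ltr0n // /M -mulrA ler_wpM2l //; last by rewrite mulrC.
  by rewrite addr_ge0 // ltW.
have Tay := mval_taylor J M0 hb Pdeg Pvan.
set D := \prod_(h < k) (q h)%:R ^+ r h : R.
have Dpos : 0 < D by apply: prodr_gt0 => h _; rewrite exprn_gt0 // ltr0n; case: (hu h).
apply: (mulfI (lt0r_neq0 Dpos)); rewrite mulr0; apply: int_small_eq0.
  by apply: mval_denominator => // h _; case: (hu h).
rewrite normrM gtr0_norm //.
have Dle : D <= expR (k%:R * ((1 + eps) * L)).
  apply: prod_expR_le => h hk; have /andP[_ h2] := rL h hk; split=> //.
  by case: (hu h).
have T0 : 0 < 2 * (1 + `|x|) by rewrite mulr_gt0 // ltr_wpDr.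
have TP : (2 * (1 + `|x|)) ^+ S * mnorm P <= expR (k%:R * eps * L).
  have P1 := mnorm_ge1 Pint Pnz; have P0 := lt_le_trans ltr01 P1.
  rewrite -[leLHS]lnK ?posrE ?mulr_gt0 ?exprn_gt0 // ler_expR lnM ?posrE ?exprn_gt0 //.
  rewrite lnXn // -[X in X + _]mulr_natl; apply: le_trans (lerD (lexx _) lnP) _; rewrite -mulrDr.
  have c20 : 0 <= ln (2 * (1 + `|x|)) + ln A%:R.
    by rewrite addr_ge0 // ln_ge0 // ger1_mul2D1.
  apply: le_trans (ler_wpM2r c20 hS) _.
  have : ln (2 * (1 + `|x|)) + ln A%:R <= eps * ln (q 0%N)%:R.
    by rewrite [leRHS]mulrC -ler_pdivrMr.
  move=> h; rewrite /L [leRHS](_ : _ = k%:R * r0%:R * (eps * ln (q 0%N)%:R)); last by ring.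
  by rewrite ler_wpM2l // mulr_ge0.
apply: le_lt_trans (ler_wpM2l (ltW Dpos) Tay) _.
apply: (@le_lt_trans _ _ (expR (k%:R * ((1 + eps) * L)) * (expR (k%:R * eps * L) *
   expR (- (M * (th - eps)))))).
  have TP0 : 0 <= (2 * (1 + `|x|)) ^+ S * mnorm P.
    by rewrite mulr_ge0 ?mnorm_ge0 // exprn_ge0 // ltW.
  apply: (ler_pM (ltW Dpos) (mulr_ge0 TP0 (expR_ge0 _)) Dle).
  apply: (ler_pM TP0 (expR_ge0 _) TP).
  by rewrite ler_expR lerN2 ler_wpM2l // lerB // ltW.
rewrite -!expRD -[ltRHS]expR0 ltr_expR.
have k1 : 1 <= k%:R :> R by rewrite ler1n.
by apply: roth_exponent; rewrite ?d0 ?delta1.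
Qed.
End Roth.

(** * Convergents *)

Section Window.
Variables (m : nat) (a : 'I_m -> nat -> int) (init : nat -> int).

Lemma mcf_windowS n : (mcf_window a init n.+1)`_0 =
  \sum_(j < m) a j n * (mcf_window a init n)`_j + (mcf_window a init n)`_m.
Proof. by []. Qed.

Lemma nth_mcf_window n l : (l < n)%N ->
  (mcf_window a init n)`_l = mcf_rec a init (n.-1 - l).
Proof.
elim: n l => [//|n IH] [|l] hl; first by rewrite subn0.
rewrite [LHS]/= IH //; congr (mcf_rec _ _ _).
by case: n hl {IH} => // n hl; rewrite subSS.
Qed.

Lemma nth_mcf_window0 l : (l <= m)%N -> (mcf_window a init 0)`_l = init l.
Proof. by move=> hl; rewrite /= nth_mkseq. Qed.
End Window.

(* The recurrence can be run backwards, because the coefficient of the oldest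
   term is 1. *)
Lemma mcf_rec_backward m (a : 'I_m -> nat -> int) (i1 i2 : nat -> int) (P Q : int) N :
  (forall n, (N <= n)%N -> Q * mcf_rec a i1 n = P * mcf_rec a i2 n) ->
  forall l, (l <= m)%N -> Q * i1 l = P * i2 l.
Proof.
move=> h.
pose z n l := Q * (mcf_window a i1 n)`_l - P * (mcf_window a i2 n)`_l.
have zS n : (forall l, (l <= m)%N -> z n.+1 l = 0) -> forall l, (l <= m)%N -> z n l = 0.
  move=> hz; have zlt l : (l < m)%N -> z n l = 0 by move=> hl; exact: hz l.+1 hl.
  move=> l; rewrite leq_eqVlt => /orP[/eqP ->|]; last exact: zlt.
  have := hz 0%N (leq0n _); rewrite /z !mcf_windowS !mulrDr !mulr_sumr => E.
  rewrite -[RHS]E opprD addrACA -sumrB big1 ?add0r // => j _.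
  rewrite !mulrA [Q * _]mulrC [P * _]mulrC -!mulrA -mulrBr.
  by have := zlt j (ltn_ord j); rewrite /z => ->; rewrite mulr0.
have z0 n : (forall l, (l <= m)%N -> z n l = 0) -> forall l, (l <= m)%N -> z 0%N l = 0.
  by elim: n => [//|n IH] /zS.
(* The window number N + m + 1 contains only terms of index at least N, where the relation is
   known. *)
move=> l hl; have := z0 (N + m.+1)%N _ l hl; rewrite /z !nth_mcf_window0 // => E.
apply/eqP; rewrite -subr_eq0; apply/eqP/E => j hj.
by rewrite !nth_mcf_window ?h ?subrr //; lia.
Qed.

Section Denominators.
Variables (m : nat) (a : 'I_m -> nat -> int) (j0 : 'I_m).
Hypothesis j0E : j0 = 0%N :> nat.
Hypothesis a_ge0 : forall n j, (0 < n)%N -> 0 <= a j n.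
Hypothesis a_gt0 : forall n, (0 < n)%N -> 1 <= a j0 n.

(** The induction starts at the window that contains C_0: C_0 = 1 whatever the partial quotients of
    index 0 are, since only the oldest initial value is nonzero. *)
Lemma mcf_den_window n : 1 <= (mcf_window a (fun p => (p == m)%:R) n.+1)`_0 /\
  forall l, 0 <= (mcf_window a (fun p => (p == m)%:R) n.+1)`_l.
Proof.
elim: n => [|n [IH0 IH]].
  have w0 l : (mcf_window a (fun p => (p == m)%:R) 0)`_l = (l == m)%:R.
    have [hl|hl] := leqP l m; first by rewrite nth_mcf_window0.
    by rewrite /= nth_default ?size_mkseq // gtn_eqF.
  have E : (mcf_window a (fun p => (p == m)%:R) 1)`_0 = 1.
    rewrite mcf_windowS w0 eqxx big1 ?add0r // => j _.
    by rewrite w0 ltn_eqF ?mulr0.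
  split=> [|[|l]]; rewrite ?E //.
  by rewrite [X in 0 <= X]w0; case: eqP.
have h : 1 <= (mcf_window a (fun p => (p == m)%:R) n.+2)`_0.
  rewrite mcf_windowS (bigD1 j0) //= -addrA; apply: ler_wpDr.
    by rewrite addr_ge0 ?IH ?sumr_ge0 // => j _; rewrite mulr_ge0 ?a_ge0 ?IH.
  by rewrite j0E -[1]mulr1 ler_pM // a_gt0.
by split=> [//|[|l]]; [exact: le_trans h|exact: IH].
Qed.

Lemma mcf_den_ge1 n : 1 <= mcf_den a n.
Proof. by case: (mcf_den_window n). Qed.

Lemma mcf_den_ge n : a j0 n.+1 * mcf_den a n <= mcf_den a n.+1.
Proof.
have [_ h] := mcf_den_window n.
rewrite /mcf_den /mcf_rec [X in _ <= X]mcf_windowS (bigD1 j0) //= j0E -addrA lerDl.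
by rewrite addr_ge0 ?h ?sumr_ge0 // => j _; rewrite mulr_ge0 ?a_ge0 ?h.
Qed.
End Denominators.

(** * From the growth condition to rational approximations *)

Section Application.
Variable R : realType.

Lemma telescoping_limit (x g : nat -> R) (l c : R) : 0 <= c ->
  (forall n, `|x n.+1 - x n| <= c * (g n - g n.+1)) -> (forall n, 0 <= g n) ->
  (x n @[n --> \oo] --> l)%classic -> forall n, `|l - x n| <= c * g n.
Proof.
move=> c0 hx g0 hl n.
have tele N : `|x (n + N)%N - x n| <= c * (g n - g (n + N)%N).
  elim: N => [|N IH]; first by rewrite addn0 !subrr normr0 mulr0.
  rewrite addnS -(subrKA (x (n + N)%N)); apply: le_trans (ler_normD _ _) _.
  by rewrite (le_trans (lerD (hx _) IH)) // -mulrDr addrC subrKA.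
apply/ler_addgt0Pr => e e0.
have /cvgrPdist_lt/(_ _ e0) [N _ hN] := hl.
rewrite -(subrKA (x (n + N)%N)); apply: le_trans (ler_normD _ _) _.
rewrite addrC lerD //; last by apply/ltW/hN; rewrite /= leq_addl.
by apply: le_trans (tele N) _; rewrite ler_wpM2l // gerBl.
Qed.

Lemma algebraic_int_root (x : R) : algebraicOver (ratr : rat -> R) x ->
  exists2 f : {poly int}, f != 0 & root (map_poly intr f) x.
Proof.
case=> p pnz rp; have [f [b b0 E]] := rat_poly_scale p.
exists f.
  by apply: contraNneq pnz => f0; rewrite E f0 rmorph0 scaler0.
move: rp; rewrite E map_polyZ /= rootZ ?fmorph_eq0 ?invr_eq0 ?intr_eq0 //.
rewrite -map_poly_comp; congr (root _ _); apply: eq_map_poly => z /=.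
by rewrite ratr_int.
Qed.

Lemma reduced_fraction (u v : int) : 0 < v -> exists p q,
  [/\ (0 < q)%N, coprimez p q, q%:Z <= v & u%:~R / v%:~R = p%:~R / q%:R :> R].
Proof.
move=> v0; have [q Eq] : exists q : nat, v = q%:Z by exists `|v|%N; rewrite gtz0_abs.
pose g := gcdz u v.
have g0 : 0 < g by rewrite lt0r /g gcdz_eq0 negb_and (gt_eqF v0) orbT.
have gu : (g %| u)%Z by apply: dvdz_gcdl.
have gv : (g %| v)%Z by apply: dvdz_gcdr.
have v'0 : 0 < (v %/ g)%Z.
  by rewrite -(pmulr_lgt0 _ g0) divzK.
exists (u %/ g)%Z, `|(v %/ g)%Z|%N; split.
- by rewrite absz_gt0 gt_eqF.
- rewrite gtz0_abs // /coprimez; apply/eqP/(mulIf (lt0r_neq0 g0)).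
  by have := mulz_gcdl (u %/ g)%Z (v %/ g)%Z g; rewrite !divzK // gtz0_abs // mul1r.
- by rewrite gtz0_abs // -[leRHS](divzK gv) ler_peMr ?(ltW v'0) // -gtz0_ge1.
rewrite -[`|_|%:R]/((`|(v %/ g)%Z|%N)%:~R) gtz0_abs //.
rewrite -{1}(divzK gu) -{1}(divzK gv) !rmorphM /= -mulf_div divff ?mulr1 //.
by rewrite intr_eq0 gt_eqF.
Qed.

(** Multiplied by B!, the sequence consists of integers, and a convergent sequence of integers is
    eventually constant. *)
Lemma bounded_denominators_cvg (x : nat -> R) (l : R) B :
  (forall n, exists (p : int) q, (0 < q <= B)%N /\ x n = p%:~R / q%:R) ->
  (x n @[n --> \oo] --> l)%classic -> exists N, forall n, (N <= n)%N -> x n = x N.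
Proof.
move=> hx hl; have F0 : 0 < B`!%:R :> R by rewrite ltr0n fact_gt0.
have hint n : B`!%:R * x n \is a Num.int.
  have [p [q [/andP[q0 qB] ->]]] := hx n.
  have /dvdnP [e ->] : (q %| B`!)%N by rewrite dvdn_fact // q0.
  rewrite natrM -mulrA [q%:R * _]mulrC divfK ?pnatr_eq0 -?lt0n //.
  by apply: rpredM; [exact: natr_int|exact: intr_int].
have e0 : 0 < (2 * B`!%:R)^-1 :> R by rewrite invr_gt0 mulr_gt0.
have /cvgrPdist_lt/(_ _ e0) [N _ hN] := hl.
exists N => n hn; apply: (mulfI (lt0r_neq0 F0)); apply/eqP; rewrite -subr_eq0; apply/eqP.
apply: int_small_eq0; first by apply: rpredB.
rewrite -mulrBr normrM gtr0_norm // -ltr_pdivlMl // mulr1.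
rewrite -(subrKA l) (le_lt_trans (ler_normD _ _)) // -[X in _ + X]normrN opprB.
have h1 : `|l - x n| < (2 * B`!%:R)^-1 by apply: hN.
have h2 : `|l - x N| < (2 * B`!%:R)^-1 by apply: hN; rewrite /=.
have -> : B`!%:R^-1 = (2 * B`!%:R)^-1 + (2 * B`!%:R)^-1 :> R.
  by field; rewrite lt0r_neq0.
by rewrite [`|x n - l|]distrC [`|x N - l|]distrC ltrD.
Qed.

(** z^(-2-delta), in the exponential form used by [roth]. *)
Definition decay (delta : R) (z : int) : R := expR (- ((2 + delta) * ln z%:~R)).

(** If the determinant is nonzero, its absolute value is at least 1, so w >= 2 and v' >= 2 v; then
    decay v' <= decay v / 4, which gives decay v <= 4/3 (decay v - decay v'). If it is zero,
    monotonicity of [decay] is enough. *)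
Lemma approximation_step (u u' v v' : int) (w : int) (delta : R) : 0 < delta ->
  1 <= v -> 1 <= w -> w * v <= v' ->
  `|(u' * v - u * v')%:~R| * v%:~R `^ delta < w%:~R :> R ->
  `|u'%:~R / v'%:~R - u%:~R / v%:~R| <= 4 / 3 * (decay delta v - decay delta v').
Proof.
move=> d0 v1 w1 hv' hw; pose g := decay delta; rewrite -/(g v) -/(g v').
set t := (u' * v - u * v')%R.
have v0 : 0 < v by apply: lt_le_trans v1.
have vv' : v <= v' by apply: le_trans hv'; rewrite ler_peMl // ltW.
have v'0 : 0 < v' by apply: lt_le_trans vv'.
have V0 : 0 < v%:~R :> R by rewrite ltr0z.
have V'0 : 0 < v'%:~R :> R by rewrite ltr0z.
have VV' : v%:~R <= v'%:~R :> R by rewrite ler_int.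
have E : u'%:~R / v'%:~R - u%:~R / v%:~R = t%:~R / (v'%:~R * v%:~R) :> R.
  by rewrite /t rmorphB !rmorphM /=; field; rewrite !lt0r_neq0.
have gle : g v' <= g v.
  by rewrite ler_expR lerN2 ler_wpM2l ?ler_ln ?posrE // addr_ge0 // ltW.
rewrite E normrM [`|(_ * _)^-1|]gtr0_norm ?invr_gt0 ?mulr_gt0 //.
have [t0|tnz] := eqVneq t 0.
  by rewrite t0 normr0 mul0r mulr_ge0 // subr_ge0.
have t1 : 1 <= `|t%:~R| :> R by rewrite norm_intr_ge1 ?intr_int // intr_eq0.
have W0 : 0 < w%:~R :> R by rewrite ltr0z; apply: lt_le_trans w1.
have lnv0 : 0 <= ln v%:~R :> R by rewrite ln_ge0 // (ler_int R 1).
have pe : v%:~R `^ delta = expR (delta * ln v%:~R) by rewrite /powR gt_eqF.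
have p1 : 1 <= v%:~R `^ delta by rewrite pe -[leLHS]expR0 ler_expR mulr_ge0 // ltW.
have w2 : 2 <= w.
  suff : 1 < w by lia.
  rewrite -(ltr_int R); apply: le_lt_trans hw; rewrite -[leLHS]mulr1.
  by rewrite ler_pM // ltW.
have hV' : w%:~R * v%:~R <= v'%:~R :> R by rewrite -intrM ler_int.
have lnv' : ln v%:~R + ln 2 <= ln v'%:~R :> R.
  rewrite addrC -lnM ?posrE // ler_ln ?posrE ?mulr_gt0 //.
  apply: le_trans hV'; rewrite ler_pM2r // -[2]/(2%:~R) ler_int; exact: w2.
have g4 : g v' <= g v / 4.
  have -> : 4^-1 = expR (- (2 * ln 2)) :> R.
    by rewrite mulrC mulr_natr expRN mulr2n expRD lnK ?posrE // -natrM.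
  rewrite /g /decay -expRD ler_expR -opprD lerN2.
  have ln20 : 0 <= ln 2 :> R by rewrite ln_ge0 // ler1n.
  have h1 : (2 + delta) * (ln v%:~R + ln 2) <= (2 + delta) * ln v'%:~R.
    by rewrite ler_wpM2l // addr_ge0 // ltW.
  by apply: le_trans h1; rewrite mulrDr lerD2l ler_wpM2r // lerDl ltW.
apply: (@le_trans _ _ (g v)); last by lra.
have -> : g v = (v%:~R `^ delta * v%:~R ^+ 2)^-1.
  rewrite /g /decay expRN pe -{3}[v%:~R]lnK ?posrE // -expRM_natl -expRD.
  by congr (expR _)^-1; rewrite mulrDl addrC.
rewrite ler_pdivrMr ?mulr_gt0 // mulrC ler_pdivlMr ?mulr_gt0 ?exprn_gt0 ?powR_gt0 //.
apply: (@le_trans _ _ (w%:~R * v%:~R ^+ 2)).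
  by rewrite mulrA ler_wpM2r ?exprn_ge0 // ltW.
by rewrite expr2 mulrA ler_wpM2r // ltW.
Qed.
End Application.

Theorem theorem21 (R : realType) (m : nat) (hm : (2 <= m)%N)
    (a : 'I_m -> nat -> int) (alpha : 'I_m -> R) (delta : R)
    (ha : admissible a) (hcvg : mcf_converges_to a alpha) (hdelta : 0 < delta)
    (hgrowth : forall n : nat, (1 <= n)%N ->
       \big[Num.max/0]_(i < m)
          (`|(mcf_tnum a i n)%:~R : R| * (mcf_den a n.-1)%:~R `^ delta)
       < (a (Ordinal (ltnW hm)) n)%:~R) :
  forall i : 'I_m, transcendental (alpha i).
Proof.
move=> i /algebraic_int_root [f fnz rf].
set j0 := Ordinal (ltnW hm) in hgrowth.
have a_ge0 n j : (0 < n)%N -> 0 <= a j n by move=> /ha [].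
have a_ge1 n : (0 < n)%N -> 1 <= a j0 n.
  (* The maximum is taken with default value 0, so it is nonnegative and the partial quotient is
     positive. *)
  move=> /hgrowth h; rewrite -gtz0_ge1 -(ltr_int R); apply: le_lt_trans h.
  exact: bigmax_ge_id.
pose C n := mcf_den a n; pose A n := mcf_num a i n.
have C1 n : 1 <= C n := mcf_den_ge1 (erefl : j0 = 0%N :> nat) a_ge0 a_ge1 n.
have CS n : a j0 n.+1 * C n <= C n.+1 := mcf_den_ge (erefl : j0 = 0%N :> nat) a_ge0 a_ge1 n.
pose x n : R := (A n)%:~R / (C n)%:~R.
pose g := decay delta.
have xlim : (x n @[n --> \oo] --> alpha i)%classic := hcvg i.
have approx n : `|alpha i - x n| <= 4 / 3 * g (C n).
  apply: (@telescoping_limit _ x (fun n => g (C n))) => // [k|k]; last exact: expR_ge0.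
  apply: (approximation_step hdelta (C1 k) (a_ge1 k.+1 isT) (CS k)).
  apply: le_lt_trans (hgrowth k.+1 isT).
  exact: (le_bigmax 0 (fun l : 'I_m =>
    `|(mcf_tnum a l k.+1)%:~R : R| * (mcf_den a k)%:~R `^ delta) i).
(* Roth's theorem is applied with half of delta; the other half absorbs the constant 4/3. *)
have d20 : 0 < delta / 2 by rewrite divr_gt0.
have [B hB] := roth fnz rf d20.
(* Beyond 2^(2 / delta) one has q^(delta / 2) >= 2 > 4/3; smaller denominators are bounded
   anyway. *)
pose B' := maxn B (Num.truncn (expR (2 / delta * ln 2) : R)).+1.
have den n : exists (p : int) q, (0 < q <= B')%N /\ x n = p%:~R / q%:R.
  have [p [q [q0 cpq qC E]]] := reduced_fraction R (A n) (lt_le_trans ltr01 (C1 n)).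
  exists p, q; rewrite q0 /= leq_max; split=> //; apply/orP.
  have [hq|hq] := leqP q (Num.truncn (expR (2 / delta * ln 2) : R)).+1; [by right|left].
  apply: hB cpq _ => //; rewrite -E; apply: le_trans (approx n) _.
  have q0' : 0 < q%:R :> R by rewrite ltr0n.
  have lnqC : ln q%:R <= ln (C n)%:~R :> R.
    rewrite ler_ln ?posrE ?ltr0z ?(lt_le_trans ltr01 (C1 n)) //.
    by rewrite -[q%:R]/((q%:Z)%:~R) ler_int.
  have ln2q : 2 / delta * ln 2 <= ln q%:R :> R.
    rewrite -[leLHS]expRK ler_ln ?posrE ?expR_gt0 //.
    have /andP[_ h] := truncn_itv (expR_ge0 (2 / delta * ln 2 : R)).
    by rewrite (le_trans (ltW h)) // ler_nat ltnW.
  have h4 : 4 / 3 <= expR (ln 2) :> R by rewrite lnK ?posrE //; lra.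
  apply: le_trans (ler_wpM2r (expR_ge0 _) h4) _; rewrite -expRD ler_expR.
  have h1 : (2 + delta) * ln q%:R <= (2 + delta) * ln (C n)%:~R.
    by rewrite ler_wpM2l // addr_ge0 // ltW.
  have h2 : ln 2 <= delta / 2 * ln q%:R.
    by rewrite -ler_pdivrMl // invf_div.
  lra.
have [N hN] := bounded_denominators_cvg den xlim.
have Cnz n : (C n)%:~R != 0 :> R.
  by rewrite intr_eq0; apply: lt0r_neq0; apply: lt_le_trans (C1 n).
have H n : (N <= n)%N -> C N * A n = A N * C n.
  move=> /hN/eqP; rewrite /x eqr_div // -!intrM eqr_int => /eqP <-.
  by rewrite mulrC.
(* At the initial position i the numerator is 1 and the denominator is 0, so the propagated relation
   reads C_N = 0. *)
have := mcf_rec_backward H (ltnW (ltn_ord i)).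
rewrite eqxx mulr1 (ltn_eqF (ltn_ord i)) mulr0 => CN0.
by have := C1 N; rewrite CN0.
Qed.
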